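(* Let $c>0$, let $Q$ be the stationary queueing process driven by a standard Brownian motion ($H=1/2$) with service rate $c$, let $0\le T_1<T_2$ and $x\ge 0$ satisfy $T_2-T_1>x$, and let $\omega(u)=(1+a)u+o(u)$ as $u\to\infty$. (i) If $a\in(-1,0)$, then as $u\to\infty$ $$\mathbb{P}\left\{\int_{T_1}^{T_2}\mathbb{I}(Q(t)>\omega(u))\,dt>x\;\Big|\;Q(0)>u\right\}\sim 1.$$ (ii) If $a>0$, then as $u\to\infty$ $$\mathbb{P}\left\{\int_{T_1}^{T_2}\mathbb{I}(Q(t)>\omega(u))\,dt>x\;\Big|\;Q(0)>u\right\}\sim e^{-2c(\omega(u)-u)}\,\mathcal{C}(T_1,T_2,x;\infty).$$
   Context: $B_{1/2}(t)$, $t\in\mathbb{R}$, is a standard two-sided Brownian motion (fractional Brownian motion with Hurst index $1/2$). The stationary queueing (workload) process with rate $c>0$ is, in law, $$\{Q(t),t\ge 0\}\stackrel{d}{=}\Big\{\sup_{s\ge t}\big(B_{1/2}(s)-B_{1/2}(t)-c(s-t)\big),\ t\ge 0\Big\};$$ it is the unique stationary solution of $Q(t)=B_{1/2}(t)-ct+\max\big(Q(0),-\inf_{s\in[0,t]}(B_{1/2}(s)-cs)\big)$, $t\ge0$. $\mathbb{I}(\cdot)$ is the indicator function, and $f(u)\sim g(u)$ means $f(u)/g(u)\to1$ as $u\to\infty$. The constant is $$\mathcal{C}(T_1,T_2,x;\infty)=2c\int_{-\infty}^{\infty}e^{2cy}\,\mathbb{P}\left\{\int_{T_1}^{T_2}\mathbb{I}\big(B_{1/2}(t)-ct>y\big)\,dt>x\right\}dy.$$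 *)

(* Defs.v *)
From HB Require Import structures.
From mathcomp Require Import all_boot all_order all_algebra.
From mathcomp Require Import all_classical all_reals all_analysis.
From mathcomp Require Import measurable_realfun.

Set Implicit Arguments.
Unset Strict Implicit.
Unset Printing Implicit Defensive.

Import Order.TTheory GRing.Theory Num.Theory.
Import numFieldNormedType.Exports.

Local Open Scope classical_set_scope.
Local Open Scope ring_scope.

(* Lets the Landau notations be used at [+oo]. *)
Canonical pinfty_filter_on (R : realType) : filter_on R :=
  FilterType (pinfty_nbhs R) _.

(* [normal_prob m s] is parameterised by the standard deviation [s], not by the
   variance. *)
Record two_sided_BM (R : realType) (d : measure_display)
    (T : measurableType d) (P : probability T R) (B : R -> {RV P >-> R}) : Prop
  := TwoSidedBM {
  BM_start : {ae P, forall w, B 0 w = 0} ;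
  BM_continuous : forall w, continuous (fun t : R => B t w) ;
  BM_increment_normal : forall (s t : R) (A : set R), s < t -> measurable A ->
    P [set w | A (B t w - B s w)] = normal_prob 0 (Num.sqrt (t - s)) A ;
  BM_increments_independent : forall (n : nat) (t : nat -> R) (A : nat -> set R),
    increasing_seq t -> (forall i, measurable (A i)) ->
    P [set w | forall i : 'I_n, A i (B (t i.+1) w - B (t i) w)] =
    (\prod_(i < n) P [set w | A i (B (t i.+1) w - B (t i) w)%R])%E
}.

(* Extended-real valued: the supremum is finite only almost surely. *)
Definition workload (R : realType) (T : Type) (c : R) (B : R -> T -> R)
    (t : R) (w : T) : \bar R :=
  ereal_sup [set (B s w - B t w - c * (s - t))%:E | s in `[t, +oo[].

(* Equality in law of two processes indexed by [0, +oo[, possibly living on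
   different probability spaces: equality of finite-dimensional distributions
   (tested on measurable rectangles, which form a pi-system). *)
Definition eq_law (R : realType) (d1 d2 : measure_display)
    (T1 : measurableType d1) (T2 : measurableType d2)
    (P1 : probability T1 R) (P2 : probability T2 R)
    (X : R -> T1 -> \bar R) (Y : R -> T2 -> \bar R) : Prop :=
  forall (n : nat) (t : 'I_n -> R) (A : 'I_n -> set \bar R),
    (forall i, 0 <= t i) -> (forall i, measurable (A i)) ->
    P1 [set w | forall i, A i (X (t i) w)] =
    P2 [set w | forall i, A i (Y (t i) w)].

(* The paths are required to be continuous because the law of the sojourn
   times below is not determined by finite-dimensional distributions alone. *)
Record stationary_queue (R : realType) (d d' : measure_display)
    (T : measurableType d) (P : probability T R)
    (T' : measurableType d') (P' : probability T' R)
    (c : R) (B : R -> {RV P >-> R}) (Q : R -> {RV P' >-> R}) : Prop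
  := StationaryQueue {
  queue_continuous : forall w,
    {within `[0, +oo[, continuous (fun t : R => Q t w)} ;
  queue_law : eq_law P' P (fun t w => (Q t w)%:E) (workload c B)
}.

(* Lebesgue measure of { t in [T1, T2] | f t > y }. *)
Definition sojourn (R : realType) (T1 T2 y : R) (f : R -> R) : R :=
  \int[lebesgue_measure]_(t in `[T1, T2]) \1_[set s | y < f s] t.

Definition cond_prob (R : realType) (d : measure_display)
    (T : measurableType d) (P : probability T R) (E F : set T) : R :=
  fine (P (E `&` F)) / fine (P F).

Definition Cconst (R : realType) (d : measure_display)
    (T : measurableType d) (P : probability T R) (B : R -> {RV P >-> R})
    (c T1 T2 x : R) : R :=
  2 * c * \int[lebesgue_measure]_(y in [set: R])
    (expR (2 * c * y) *
     fine (P [set w | x < sojourn T1 T2 y (fun t => B t w - c * t)])).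

Definition asymp_equiv (R : realType) (f g : R -> R) : Prop :=
  (fun u => f u / g u) @ +oo --> (1 : R).

(* Main.v *)
Require Import Defs.
From HB Require Import structures.
From mathcomp Require Import all_boot all_order all_algebra.
From mathcomp Require Import all_classical all_reals all_analysis.
From mathcomp Require Import measurable_realfun zify ring lra.

Set Implicit Arguments.
Unset Strict Implicit.
Unset Printing Implicit Defensive.

Import Order.TTheory GRing.Theory Num.Theory.
Import numFieldNormedType.Exports.

Local Open Scope classical_set_scope.
Local Open Scope ring_scope.

(** The workload satisfies
    [Q t = max (sup over [s] in [[t, S]] of B s - B t - c (s - t),
                Q S + B S - B t - c (S - t))].
    The fluctuations of [B] on a bounded interval have super-exponentially small
    tails, whereas [Q S] is exponential with rate [2 c]; so, up to a negligible
    error, a level [y] of order [u] is exceeded before time [S] only through the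
    second term.  For [a < 0] this makes [Q] stay above the lower level once
    [Q 0 > u].  For [a > 0] take [S = T1 + T2] and reverse time at [S]: the
    reversed increments form a Brownian motion independent of [Q S], and
    [t |-> S - t] preserves [[T1, T2]], so the probability is
    [int psi (y - q) 2c e^(-2cq) dq] over [q >= 0], where [psi] is the sojourn
    probability in the constant.  Multiplied by [e^(2cy)] this is the integral of
    [2c e^(2cz) psi z] over [z <= y], which tends to the constant.

    That [Q 0] is exponential, and all the maximal inequalities, come from
    random walks: the bounds [e^(-2cu)] and [min (1, e^(-2c(u+eps)))] are super-
    and sub-solutions of the first-step recursion for the passage probability,
    up to errors that vanish as the mesh is refined.  Path functionals pass from
    [Q] to [B] because each only depends on the path on a dyadic grid. *)

(** * Laws on path space and independent increments *)

(** Two obstacles shape the proof. The law of [Q] is given by finite-dimensional distributions,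
    whereas a sojourn time involves a continuum of times, and the workload paths built from [B] are
    never shown to be continuous. Hence [occupation], a measurable functional of grid values that
    makes sense for an arbitrary path: it equals the sojourn time on continuous paths, namely [Q]
    and at the end [drifted], and the workload enters only through its grid values. Moreover,
    conditioning divides by [e^(-2 c u)], and for [a > 0] errors are even compared with
    [e^(-2 c omega(u))]. No Gaussian tail is computed to beat these: a path that rises above [v]
    before time [S] forces the workload with an artificial drift [kappa] above [v - kappa S], which
    has probability at most [e^(-2 kappa (v - kappa S))]. With [v] proportional to [u] and [kappa] a
    free constant, every exponential rate is available. *)

Section equality_in_law.
Context (I : Type) (R : realType) (d : measure_display) (E : measurableType d).

Definition cylinder : set (set (I -> E)) :=
  [set C | exists n (t : 'I_n -> I) (A : 'I_n -> set E),
     (forall i, measurable (A i)) /\ C = [set f | forall i, A i (f (t i))]].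

Definition path_space := g_sigma_algebraType cylinder.

Lemma cylinder1 (i : I) (A : set E) : measurable A -> cylinder [set f | A (f i)].
Proof.
move=> mA; exists 1, (fun=> i), (fun=> A); split => //.
by apply/seteqP; split => f //= /(_ ord0).
Qed.

(** Times may repeat in a cylinder, so concatenating the two lists of constraints suffices. *)
Lemma cylinder_setI : setI_closed cylinder.
Proof.
move=> _ _ [n [t [A [mA ->]]]] [m [s [C [mC ->]]]].
exists (n + m)%N.
exists (fun k => match fintype.split k with inl i => t i | inr j => s j end).
exists (fun k => match fintype.split k with inl i => A i | inr j => C j end); split.
  by move=> k /=; case: (fintype.split k).
apply/seteqP; split => f /=.
  by move=> [fA fC] k; case: (fintype.split k).
move=> H; split => [i|j].
  by have := H (lshift m i); rewrite (unsplitK (inl i)).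
by have := H (rshift n j); rewrite (unsplitK (inr j)).
Qed.

Lemma measurable_coord (i : I) :
  measurable_fun [set: path_space] (fun f : path_space => f i).
Proof.
by move=> _ A mA; rewrite setTI; apply: sub_sigma_algebra; exact: cylinder1.
Qed.

Lemma measurable_to_path (d' : measure_display) (T : measurableType d')
    (X : I -> T -> E) : (forall i, measurable_fun [set: T] (X i)) ->
  @measurable_fun _ _ T path_space setT (fun w i => X i w).
Proof.
move=> mX; apply: (@measurability _ _ T path_space _ _ cylinder) => //.
move=> _ [_ [n [t [A [mA ->]]]] <-]; rewrite setTI.
have -> : (fun w i => X i w) @^-1`
    [set f | forall i, A i (f (t i))] =
    \bigcap_(i in [set: 'I_n]) (X (t i) @^-1` A i).
  by apply/seteqP; split => w /=; [move=> h i _; exact: h|move=> h i; exact: h].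
apply: fin_bigcap_measurable => // i _; rewrite -[X in measurable X]setTI.
exact: mX.
Qed.

Context (d1 d2 : measure_display) (T1 : measurableType d1)
  (T2 : measurableType d2) (m1 : probability T1 R) (m2 : probability T2 R) (X : I -> T1 -> E) (Y : I -> T2 -> E).
Hypotheses (mX : forall i, measurable_fun [set: T1] (X i))
  (mY : forall i, measurable_fun [set: T2] (Y i)).
Hypothesis XY : forall n (t : 'I_n -> I) (A : 'I_n -> set E),
  (forall i, measurable (A i)) ->
  m1 [set w | forall i, A i (X (t i) w)] = m2 [set w | forall i, A i (Y (t i) w)].

(** Cylinders form a pi-system generating the sigma-algebra, so agreement on them extends to every
    event, including those that involve countably many coordinates. *)
Lemma eq_law_path (G : set path_space) : measurable G ->
  m1 [set w | G (fun i => X i w)] = m2 [set w | G (fun i => Y i w)].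
Proof.
move=> mG.
pose X' := mfun_Sub (mem_set (measurable_to_path mX)).
pose Y' := mfun_Sub (mem_set (measurable_to_path mY)).
apply: (@measure_unique _ _ path_space cylinder (fun=> setT) erefl
  cylinder_setI _ _ (pushforward m1 X') (pushforward m2 Y')) => //.
(* The whole space is the cylinder over no coordinate. *)
- move=> _; exists 0, (fun i : 'I_0 => match i with Ordinal _ h => False_rect _ (notF h) end).
  by exists (fun=> setT); split => //; apply/seteqP; split.
- by apply/seteqP; split => // f _; exists 0%N.
- by move=> _ [n [t [A [mA ->]]]]; exact: XY.
- move=> _; apply: (@le_lt_trans _ _ 1%E); last exact: ltry.
  by apply: probability_le1; rewrite preimage_setT.
Qed.

End equality_in_law.

(** [nu] is a bare set function, so that an image law can be written as [nu] of a preimage without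
    building a measure. *)
Definition iid (R : realType) (d : measure_display) (T : measurableType d)
    (P : probability T R) (eta : nat -> T -> R) (nu : set R -> \bar R) : Prop :=
  (forall i, measurable_fun [set: T] (eta i)) /\
  forall (n : nat) (A : nat -> set R), (forall i, measurable (A i)) ->
  P [set w | forall i : 'I_n, A i (eta i w)] = (\prod_(i < n) nu (A i))%E.

Section iid.
Context (R : realType) (d d' : measure_display) (T : measurableType d)
  (T' : measurableType d') (P : probability T R) (P' : probability T' R)
  (eta : nat -> T -> R) (zeta : nat -> T' -> R) (nu : set R -> \bar R).
Hypotheses (etaP : iid P eta nu) (zetaP : iid P' zeta nu).

Lemma iid_setT : nu setT = 1%E.
Proof.
have := etaP.2 1 (fun=> setT) (fun=> measurableT).
rewrite big_ord1 => <-; rewrite -[RHS](probability_setT P); congr (P _).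
by apply/seteqP; split.
Qed.

Lemma iid_map (f : R -> R) : measurable_fun setT f ->
  iid P (fun i w => f (eta i w)) (fun A => nu (f @^-1` A)).
Proof.
move=> mf; split=> [i|n A mA].
  by apply: measurableT_comp => //; exact: etaP.1.
rewrite -(etaP.2 n (fun i => f @^-1` A i)) // => i.
by rewrite -[X in measurable X]setTI; exact: mf.
Qed.

Lemma iid_law (G : set (path_space nat R)) : measurable G ->
  P [set w | G (fun i => eta i w)] = P' [set w | G (fun i => zeta i w)].
Proof.
move=> mG; apply: eq_law_path => //; [exact: etaP.1|exact: zetaP.1|].
move=> n t A mA.
(* The indices [t j] may repeat or skip values: [A' k] intersects all constraints at index [k], and
   is the full set if there are none. *)
pose A' (k : nat) := [set z | forall j, t j = k -> A j z].
have mA' k : measurable (A' k).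
  have -> : A' k = \bigcap_(j in [set j | t j = k]) A j by [].
  by apply: fin_bigcap_measurable => //; exact: finite_finset.
have E (U : Type) (X : nat -> U -> R) : [set w | forall i, A i (X (t i) w)] =
    [set w | forall i : 'I_(\max_i t i).+1, A' i (X i w)].
  apply/seteqP; split => w /= H.
    by move=> i j <-; exact: H.
  move=> i; have ti : (t i < (\max_i t i).+1)%N by rewrite ltnS; exact: leq_bigmax.
  exact: (H (Ordinal ti) i).
by rewrite !E etaP.2// zetaP.2.
Qed.

(* The first [k] terms are read backwards; for [k = 1] this is a first-step
   decomposition, for larger [k] a time reversal followed by an independent
   future. *)
Lemma iid_cat (k : nat) :
  iid (P \x P')%E (fun i (w : T * T') =>
    if (i < k)%N then eta (k.-1 - i) w.1 else zeta (i - k) w.2) nu.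
Proof.
split=> [i|n A mA].
  case: (ltnP i k) => _.
    by apply: measurableT_comp => //; exact: etaP.1.
  by apply: measurableT_comp => //; exact: zetaP.1.
(* The variable [eta i] is output at position [k.-1 - i]; it is unconstrained when that position is
   beyond the first [n]. *)
pose A1 i := if (k.-1 - i < n)%N then A (k.-1 - i)%N else setT.
pose A2 i := A (i + k)%N.
have mset dU (U : measurableType dU) (Q : nat -> set U) m : (forall i, measurable (Q i)) ->
    measurable [set w | forall i : 'I_m, Q i w].
  move=> mQ; have -> : [set w | forall i : 'I_m, Q i w] =
      \bigcap_(i in [set: 'I_m]) Q i.
    by apply/seteqP; split => w /= h i; [move=> _; exact: h|exact: h].
  exact: fin_bigcap_measurable.
have -> : [set w : T * T' | forall i : 'I_n,
    A i (if (i < k)%N then eta (k.-1 - i) w.1 else zeta (i - k) w.2)] =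
    [set w | forall i : 'I_k, A1 i (eta i w)] `*`
    [set w | forall i : 'I_(n - k), A2 i (zeta i w)].
  apply/seteqP; split => -[w1 w2] /=.
    move=> H; split => i; rewrite /A1 /A2.
      case: ifPn => // lin; have := H (Ordinal lin) => /=.
      have ik := ltn_ord i.
      have -> : (k.-1 - i < k)%N by rewrite (leq_ltn_trans (leq_subr _ _))// ltn_predL (leq_ltn_trans _ ik).
      by rewrite subKn// -ltnS prednK// (leq_ltn_trans _ ik).
    have lin : (i + k < n)%N by rewrite addnC -ltn_subRL.
    by have := H (Ordinal lin); rewrite /= ltnNge leq_addl /= addnK.
  move=> [H1 H2] i; case: ifPn => ik.
    have k0 : (0 < k)%N by exact: leq_ltn_trans ik.
    have lk : (k.-1 - i < k)%N by rewrite (leq_ltn_trans (leq_subr _ _))// ltn_predL.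
    have := H1 (Ordinal lk); rewrite /= /A1 subKn ?ltn_ord//.
    by rewrite -ltnS prednK.
  rewrite -leqNgt in ik.
  have lnk : (i - k < n - k)%N by rewrite ltn_sub2r// (leq_ltn_trans ik).
  by have := H2 (Ordinal lnk); rewrite /= /A2 subnK.
have mA1 i : measurable (A1 i) by rewrite /A1; case: ifP.
rewrite [LHS]product_measure1E; last 2 first.
- apply: (mset _ T (fun i => eta i @^-1` A1 i)) => i.
  by rewrite -[X in measurable X]setTI; exact: etaP.1.
- apply: (mset _ T' (fun i => zeta i @^-1` A2 i)) => i.
  by rewrite -[X in measurable X]setTI; apply: zetaP.1 => //; exact: mA.
apply: (etrans (congr2 (fun a b => a * b)%E (etaP.2 k A1 mA1)
  (zetaP.2 (n - k)%N A2 (fun i => mA _)))).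
(* Reversing the product over the first block restores the order of [A]; when [n < k] the surplus
   factors are [nu setT = 1]. *)
rewrite (reindex_inj rev_ord_inj)/= (eq_bigr (fun i : 'I_k =>
    if (i < n)%N then nu (A i) else 1%E)); last first.
  move=> i _; rewrite /A1.
  have -> : (k.-1 - (k - i.+1))%N = i by have := ltn_ord i; lia.
  by case: ifP => // _; exact: iid_setT.
rewrite -(big_mkord xpredT (fun i => nu (A2 i))).
rewrite -(big_mkord xpredT (fun i => nu (A i))).
rewrite -(big_mkord xpredT (fun i => if (i < n)%N then nu (A i) else 1%E)).
have [kn|nk] := leqP k n.
  rewrite [in RHS](big_cat_nat (n := k))//=; congr (_ * _)%E.
    by apply: eq_big_nat => i /andP[_ ik]; rewrite (leq_trans ik).
  by rewrite -[in RHS](add0n k) big_addn.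
rewrite (big_cat_nat (n := n) (p := k))//= ?(ltnW nk)//.
rewrite [X in (_ * X * _)%E]big_nat_cond [X in (_ * X * _)%E]big1 ?mule1; last first.
  by move=> i /andP[/andP[+ _] _]; rewrite leqNgt => /negbTE ->.
have -> : (n - k = 0)%N by apply/eqP; rewrite subn_eq0 ltnW.
rewrite [X in (_ * X)%E]big_geq// mule1.
by apply: eq_big_nat => i /andP[_ ->].
Qed.

End iid.

(** * First passage of a random walk *)

Lemma product_probabilityE (R : realType) (d d' : measure_display)
    (T : measurableType d) (T' : measurableType d') (P : probability T R)
    (P' : probability T' R) (A : set (T * T')) :
  (P \x P')%E A = (\int[P]_w P' [set w' | A (w, w')])%E.
Proof.
apply: eq_integral => w _ /=; congr (P' _).
by apply/seteqP; split => w'; rewrite /xsection /= inE.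
Qed.

Lemma product_probabilityE_r (R : realType) (d d' : measure_display)
    (T : measurableType d) (T' : measurableType d') (P : probability T R)
    (P' : probability T' R) (A : set (T * T')) : measurable A ->
  (P \x P')%E A = (\int[P']_w' P [set w | A (w, w')])%E.
Proof.
move=> mA; have := indic_fubini_tonelli P P' mA.
rewrite (indic_fubini_tonelli_FE P' mA) (indic_fubini_tonelli_GE P mA) => H.
apply: (etrans H); apply: eq_integral => w _ /=; congr (P _).
by apply/seteqP; split => w'; rewrite /ysection /= inE.
Qed.

Lemma measurable_lt_set (R : realType) (d : measure_display)
    (T : measurableType d) (f g : T -> R) :
  measurable_fun setT f -> measurable_fun setT g ->
  measurable [set w | f w < g w].
Proof.
move=> mf mg; have := measurable_fun_ltr mf mg.
by move=> /(_ measurableT [set true]); rewrite setTI; exact.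
Qed.

Section first_passage.
Context (R : realType) (d : measure_display) (T : measurableType d)
  (P : probability T R) (xi : nat -> T -> R) (nu : set R -> \bar R).
Hypothesis xiP : iid P xi nu.

(** The empty sum [k = 0] counts, so the event is everything when [u < 0]; this is the boundary
    condition of the recursion [passageS]. *)
Definition passage (T' : Type) (f : nat -> T' -> R) (n : nat) (u : R) : set T' :=
  [set w | exists2 k, (k <= n)%N & u < \sum_(i < k) f i w].

Lemma measurable_passage (d' : measure_display) (T' : measurableType d')
    (f : nat -> T' -> R) (v : T' -> R) n :
  (forall i, measurable_fun setT (f i)) -> measurable_fun setT v ->
  measurable [set w | passage f n (v w) w].
Proof.
move=> mf mv; have -> : [set w | passage f n (v w) w] =
    \bigcup_(k in [set k | (k <= n)%N]) [set w | v w < \sum_(i < k) f i w].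
  by apply/seteqP; split => w /= [k kn H]; exists k.
apply: bigcup_measurable => k _; apply: measurable_lt_set => //.
by apply: measurable_sum => i; exact: mf.
Qed.

Lemma measurable_prob_passage n :
  measurable_fun setT (fun v => P (passage xi n v)).
Proof.
pose A := [set z : R * T | passage (fun i z => xi i z.2) n z.1 z].
have mA : measurable A.
  apply: measurable_passage => // i.
  by apply: measurableT_comp => //; exact: xiP.1.
rewrite [X in measurable_fun _ X](_ : _ = P \o xsection A).
  exact: measurable_fun_xsection.
apply/funext => v /=; congr (P _); apply/seteqP; split => w.
  by rewrite /xsection/= inE.
by rewrite /xsection/= inE.
Qed.

Lemma measurable_passage_sub n u :
  measurable_fun setT (fun w => P (passage xi n (u - xi 0 w))).
Proof.
apply: (measurableT_comp (measurable_prob_passage n)).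
by apply: measurable_funB => //; exact: xiP.1.
Qed.

Lemma passageS n u : 0 <= u ->
  P (passage xi n.+1 u) = (\int[P]_w P (passage xi n (u - xi 0 w)))%E.
Proof.
move=> u0.
pose G : set (path_space nat R) :=
  [set f | passage (fun i (f : nat -> R) => f i) n.+1 u f].
have mG : measurable G.
  by apply: measurable_passage => // i; exact: measurable_coord.
(* On the product space the first coordinate supplies the first jump and the second one all later
   jumps. *)
apply: (etrans (iid_law xiP (iid_cat xiP xiP 1) mG)).
apply: (etrans (product_probabilityE _ _ _)); apply: eq_integral => w1 _ /=.
congr (P _); apply/seteqP; split => w2; rewrite /G /=.
  move=> [[|k] kn]; first by rewrite big_ord0 ltNge u0.
  rewrite big_ord_recl /= -ltrBlDl => H; exists k => //.
  by apply: (lt_le_trans H); rewrite le_eqVlt; apply/orP; left; apply/eqP;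
    apply: eq_bigr => i _; rewrite /bump /= subn1.
move=> [k kn H]; exists k.+1 => //; rewrite big_ord_recl /= -ltrBlDl.
by apply: (lt_le_trans H); rewrite le_eqVlt; apply/orP; left; apply/eqP;
    apply: eq_bigr => i _; rewrite /bump /= subn1.
Qed.

(** By induction along [passageS]: the moment bound makes the exponential a supersolution. Negative
    [u], where the bound is at least 1, must be included because a jump may overshoot the level. *)
Lemma passage_le (th : R) n u : 0 <= th ->
  (\int[P]_w (expR (th * xi 0 w))%:E <= 1)%E ->
  (P (passage xi n u) <= (expR (- th * u))%:E)%E.
Proof.
move=> th0 mgf; elim: n u => [|n IH] u; have [u0|u0] := leP 0 u.
- rewrite (_ : passage _ _ _ = set0) ?measure0 ?lee_fin ?expR_ge0//.
  apply/seteqP; split => w //= [k]; rewrite leqn0 => /eqP ->.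
  by rewrite big_ord0 ltNge u0.
- apply: (@le_trans _ _ 1%E); first by apply: probability_le1; exact: measurable_passage xiP.1 _.
  by rewrite lee_fin -expR0 ler_expR mulr_le0// ?oppr_le0// ltW.
- rewrite passageS//.
  apply: (@le_trans _ _ (\int[P]_w ((expR (- th * u))%:E * (expR (th * xi 0 w))%:E)))%E.
    apply: ge0_le_integral => //.
    + exact: measurable_passage_sub.
    + apply: emeasurable_funM => //; apply/measurable_EFinP => //.
      apply: measurableT_comp => //; apply: measurable_funM => //; exact: xiP.1.
    + move=> w _; rewrite -EFinM -expRD; apply: (le_trans (IH _)).
      by rewrite lee_fin ler_expR; lra.
  rewrite ge0_integralZl//.
  + by rewrite -[leRHS]mule1 lee_pmul2l// lte_fin expR_gt0.
  + apply/measurable_EFinP => //; apply: measurableT_comp => //.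
    by apply: measurable_funM => //; exact: xiP.1.
- apply: (@le_trans _ _ 1%E); first by apply: probability_le1; exact: measurable_passage xiP.1 _.
  by rewrite lee_fin -expR0 ler_expR mulr_le0// ?oppr_le0// ltW.
Qed.

Lemma measurable_expR_xi (a : R) :
  measurable_fun setT (fun w => (expR (a * xi 0 w))%:E).
Proof.
apply/measurable_EFinP; apply: measurableT_comp => //.
by apply: measurable_funM => //; exact: xiP.1.
Qed.

Lemma integral_expR_xi (k a : R) : 0 <= k ->
  (\int[P]_w (k%:E * (expR (a * xi 0 w))%:E) =
   k%:E * \int[P]_w (expR (a * xi 0 w))%:E)%E.
Proof. by move=> k0; rewrite ge0_integralZl//; exact: measurable_expR_xi. Qed.

(* The bound [min(1, e^{-2c(u+eps)})] solves the first-step recursion up to the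
   error [r] made by jumping above [eps], and up to its mass on paths that are
   still nonnegative, which the second exponential moment makes decay. *)
Lemma passage_ge (c eps th b B : R) n u : 0 < c -> 0 <= eps -> 2 * c <= th ->
  0 <= b -> 0 <= B ->
  (\int[P]_w (expR (2 * c * xi 0 w))%:E = 1)%E ->
  (\int[P]_w (expR (c * xi 0 w))%:E <= b%:E)%E ->
  (\int[P]_w (expR (th * xi 0 w))%:E <= B%:E)%E ->
  ((Num.min 1 (expR (- (2 * c * (u + eps)))))%:E <= P (passage xi n u) +
   (n%:R * (expR (- (th * eps)) * B) + expR (- (c * u)) * b ^+ n)%:E)%E.
Proof.
move=> c0 eps0 cth b0 B0 m2c mc mth.
have r0 : 0 <= expR (- (th * eps)) * B by rewrite mulr_ge0 ?expR_ge0.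
have Hneg m v : v < 0 -> ((Num.min 1 (expR (- (2 * c * (v + eps)))))%:E <=
    P (passage xi m v) +
    (m%:R * (expR (- (th * eps)) * B) + expR (- (c * v)) * b ^+ m)%:E)%E.
  move=> v0; rewrite (_ : passage _ _ _ = setT) ?probability_setT; last first.
    by apply/seteqP; split => w // _; exists 0 => //; rewrite big_ord0.
  rewrite -EFinD lee_fin ge_min; apply/orP; left; rewrite lerDl.
  by rewrite addr_ge0// mulr_ge0// ?expR_ge0// exprn_ge0.
elim: n u => [|n IH] u; have [u0|u0] := leP 0 u; try exact: Hneg.
  rewrite (_ : passage _ _ _ = set0) ?measure0; last first.
    apply/seteqP; split => w //= [k]; rewrite leqn0 => /eqP ->.
    by rewrite big_ord0 ltNge u0.
  rewrite add0e lee_fin mul0r add0r expr0 mulr1 ge_min; apply/orP; right.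
  by rewrite ler_expR; nra.
(* The minimum with 1 is removed at the cost of [e^(-th (v + eps))]: it is inactive when
   [v + eps >= 0], and otherwise [2 c <= th] makes the added term dominate. *)
have key v : ((expR (- (2 * c * (v + eps))))%:E <= P (passage xi n v) +
    ((n%:R * (expR (- (th * eps)) * B))%:E + (expR (- (c * v)) * b ^+ n)%:E +
     (expR (- (th * (v + eps))))%:E))%E.
  have : ((Num.min 1 (expR (- (2 * c * (v + eps)))) +
           expR (- (th * (v + eps))))%:E <=  P (passage xi n v) +
    ((n%:R * (expR (- (th * eps)) * B))%:E + (expR (- (c * v)) * b ^+ n)%:E +
     (expR (- (th * (v + eps))))%:E))%E.
    by rewrite EFinD addeA; apply: leeD => //; rewrite -EFinD; exact: IH.
  apply: le_trans; rewrite lee_fin.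
  have [ve|ve] := leP 0 (v + eps).
    rewrite (min_idPr _) ?lerDl ?expR_ge0//.
    by rewrite -expR0 ler_expR oppr_le0 !mulr_ge0// ltW.
  apply: (@le_trans _ _ (expR (- (th * (v + eps))))).
    by rewrite ler_expR lerN2 ler_wnM2r// ltW.
  by rewrite lerDr le_min ler01 expR_ge0.
have mE k a : measurable_fun setT (fun w => k%:E * (expR (a * xi 0 w))%:E)%E.
  by apply: emeasurable_funM => //; exact: measurable_expR_xi.
apply: (@le_trans _ _ (expR (- (2 * c * (u + eps))))%:E).
  by rewrite lee_fin ge_min lexx orbT.
(* The moment of order [2 c] being 1, this exponential is harmonic for the walk: it is the mean of
   its value after one jump. *)
have -> : (expR (- (2 * c * (u + eps))))%:E =
    (\int[P]_w (expR (- (2 * c * (u - xi 0 w + eps))))%:E)%E.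
  rewrite -[LHS]mule1 -m2c -integral_expR_xi ?expR_ge0//.
  by apply: eq_integral => w _; rewrite -EFinM -expRD; congr (expR _)%:E; ring.
apply: (@le_trans _ _ (\int[P]_w (P (passage xi n (u - xi 0 w)) +
    ((n%:R * (expR (- (th * eps)) * B))%:E +
     (expR (- (c * u)) * b ^+ n)%:E * (expR (c * xi 0 w))%:E +
     (expR (- (th * (u + eps))))%:E * (expR (th * xi 0 w))%:E)))%E).
  apply: ge0_le_integral => //.
  - apply/measurable_EFinP; apply: measurableT_comp => //.
    apply: measurableT_comp => //; apply: measurable_funM => //.
    by apply: measurable_funD => //; apply: measurable_funB => //; exact: xiP.1.
  - apply: emeasurable_funD; first exact: measurable_passage_sub.
    by apply: emeasurable_funD => //; apply: emeasurable_funD.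
  - move=> w _; apply: (le_trans (key _)); apply: leeD => //.
    rewrite -!EFinM -!EFinD lee_fin mulrAC -!expRD.
    have -> : - (c * (u - xi 0 w)) = - (c * u) + c * xi 0 w by ring.
    by have -> : - (th * (u - xi 0 w + eps)) =
      - (th * (u + eps)) + th * xi 0 w by ring.
have bn0 : 0 <= expR (- (c * u)) * b ^+ n by rewrite mulr_ge0 ?expR_ge0 ?exprn_ge0.
rewrite ge0_integralD//; last 3 first.
- exact: measurable_passage_sub.
- by move=> w _; rewrite !adde_ge0 ?mule_ge0 ?lee_fin ?expR_ge0// mulr_ge0.
- by apply: emeasurable_funD => //; apply: emeasurable_funD.
rewrite -passageS//; apply: leeD => //.
rewrite ge0_integralD//; last 2 first.
- by move=> w _; rewrite !adde_ge0 ?mule_ge0 ?lee_fin ?expR_ge0// mulr_ge0.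
- by apply: emeasurable_funD.
rewrite ge0_integralD//; last 2 first.
- by move=> w _; rewrite lee_fin mulr_ge0.
- by move=> w _; rewrite mule_ge0 ?lee_fin ?expR_ge0.
rewrite integral_cst// [X in (_ * X + _)%E](probability_setT P) mule1 !integral_expR_xi ?expR_ge0//.
apply: (@le_trans _ _ ((n%:R * (expR (- (th * eps)) * B))%:E +
  (expR (- (c * u)) * b ^+ n)%:E * b%:E + (expR (- (th * (u + eps))))%:E * B%:E)%E).
  apply: leeD; first apply: leeD => //.
    by apply: lee_wpmul2l => //.
  by apply: lee_wpmul2l => //; rewrite lee_fin expR_ge0.
(* Since [0 <= u], one step costs at most one more copy of [e^(-th eps) B], which turns the factor
   [n] into [n + 1]. *)
have Hr : expR (- (th * (u + eps))) * B <= expR (- (th * eps)) * B.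
  by rewrite ler_wpM2r// ler_expR; nra.
by rewrite -!EFinM -!EFinD lee_fin exprSr -natr1; lra.
Qed.

End first_passage.

(** * Integrals against a density, and the Gaussian moment generating function *)

Section density.
Context (R : realType) (d : measure_display) (T : measurableType d)
  (mu nu : {measure set T -> \bar R}) (g : T -> R).
Hypotheses (mg : measurable_fun setT g) (g0 : forall x, 0 <= g x).
Hypothesis nuE : forall A, measurable A ->
  nu A = (\int[mu]_(x in A) (g x)%:E)%E.

Import HBNNSimple.

Let ge0_integral_density_nnsfun (f : {nnsfun T >-> R}) :
  (\int[nu]_x (f x)%:E = \int[mu]_x ((f x)%:E * (g x)%:E))%E.
Proof.
under [LHS]eq_integral do rewrite fimfunE -fsumEFin//.
rewrite [LHS]ge0_integral_fsum//; last 2 first.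
  - by move=> r; exact/measurable_EFinP/measurableT_comp.
  - by move=> n x _; rewrite EFinM nnfun_muleindic_ge0.
under [RHS]eq_integral.
  move=> x xD; rewrite fimfunE -fsumEFin// muleC ge0_mule_fsumr; last first.
    by move=> r; rewrite EFinM nnfun_muleindic_ge0.
  over.
rewrite [RHS]ge0_integral_fsum//; last 2 first.
  - move=> r; apply: emeasurable_funM; first exact/measurable_EFinP.
    by apply/measurable_EFinP; exact/measurableT_comp.
  - move=> n x _; apply: mule_ge0; first by rewrite lee_fin.
    by rewrite EFinM nnfun_muleindic_ge0.
apply: eq_fsbigr => r _.
have [r0|r0] := leP 0 r; last first.
  rewrite (_ : f @^-1` [set r] = set0) ?preimage_nnfun0//.
  rewrite !integral0_eq// => x _; by rewrite indic0 mulr0 ?mule0.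
under [RHS]eq_integral do rewrite EFinM muleCA.
under [LHS]eq_integral do rewrite EFinM.
have mE : measurable (f @^-1` [set r]) by exact: measurable_sfunP.
rewrite !ge0_integralZl//.
- congr (_ * _)%E; rewrite integral_indic// setIT nuE//.
  rewrite [LHS]integral_mkcond/=; apply: eq_integral => x _.
  rewrite patchE indicE; case: ifPn => // _; first by rewrite mule1.
  by rewrite mule0.
- apply: emeasurable_funM; first exact/measurable_EFinP.
  by apply/measurable_EFinP; exact/measurable_indic.
- by move=> x _; rewrite mule_ge0 ?lee_fin.
- by apply/measurable_EFinP; exact/measurable_indic.
Qed.

Lemma ge0_integral_density (f : T -> \bar R) :
  measurable_fun setT f -> (forall x, 0 <= f x)%E ->
  (\int[nu]_x f x = \int[mu]_x (f x * (g x)%:E))%E.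
Proof.
move=> mf f0; pose f_ := nnsfun_approx measurableT mf.
transitivity (lim (\int[nu]_x (f_ n x)%:E @[n --> \oo])%E).
  rewrite -monotone_convergence//=.
  - apply: eq_integral => ? /[!inE] xD; apply/esym/cvg_lim => //=.
    exact: cvg_nnsfun_approx.
  - by move=> n; exact/measurable_EFinP/measurable_funTS.
  - by move=> n ? _; rewrite lee_fin.
  - by move=> ? _ ? ? mn; rewrite lee_fin; exact/lefP/nd_nnsfun_approx.
rewrite [RHS](_ : _ = lim
    (\int[mu]_x ((f_ n x)%:E * (g x)%:E)%E @[n --> \oo])%E); last first.
  rewrite -monotone_convergence//=.
  - apply: eq_integral => x /[!inE] xD; apply/esym/cvg_lim => //.
    by apply: cvgeZr => //; exact: cvg_nnsfun_approx.
  - move=> n; apply: emeasurable_funM; exact/measurable_EFinP/measurable_funTS.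
  - by move=> n ? _; rewrite mule_ge0 ?lee_fin.
  - move=> x _ ? ? ?; rewrite lee_wpmul2r ?lee_fin//.
    exact/lefP/nd_nnsfun_approx.
by apply: congr_lim; apply/funext => n /=; exact: ge0_integral_density_nnsfun.
Qed.

End density.

(** Completing the square: tilting the centred density by [e^(th x)] gives [e^(th^2 s^2 / 2)] times
    the normal density with mean [th s^2], whose integral is 1. *)
Lemma normal_mgf (R : realType) (s th : R) : s != 0 ->
  (\int[normal_prob 0 s]_x (expR (th * x))%:E = (expR (th ^+ 2 * s ^+ 2 / 2))%:E)%E.
Proof.
move=> s0; rewrite (@ge0_integral_density _ _ _ lebesgue_measure _
  (normal_pdf 0 s)) //.
- rewrite -[RHS]mule1 -(integral_normal_pdf (th * s ^+ 2) s).
  rewrite -[RHS]ge0_integralZl; last 4 first.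
  + exact: measurableT.
  + by apply/measurable_EFinP; exact: measurable_normal_pdf.
  + by move=> x _; rewrite lee_fin normal_pdf_ge0.
  + by rewrite lee_fin expR_ge0.
  apply: eq_integral => x _; rewrite -!EFinM /normal_pdf (negbTE s0).
  rewrite mulrCA [in RHS]mulrCA; congr (_ * _)%:E.
  rewrite /normal_fun -!expRD; congr expR.
  by field.
- exact: measurable_normal_pdf.
- exact: normal_pdf_ge0.
- apply/measurable_EFinP; exact: measurableT_comp.
Qed.

(** * Brownian increments along a regular grid *)

Definition increment (R : realType) (T : Type) (X : R -> T -> R)
    (t0 delta : R) (i : nat) (w : T) : R :=
  X (t0 + i.+1%:R * delta) w - X (t0 + i%:R * delta) w.

Lemma sum_increment (R : realType) (T : Type) (X : R -> T -> R)
    (t0 delta : R) (k : nat) (w : T) :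
  \sum_(i < k) increment X t0 delta i w = X (t0 + k%:R * delta) w - X t0 w.
Proof.
elim: k => [|k IH]; first by rewrite big_ord0 mul0r addr0 subrr.
by rewrite big_ord_recr /= IH /increment; ring.
Qed.

Section brownian_increments.
Context (R : realType) (d : measure_display) (T : measurableType d)
  (P : probability T R) (B : R -> {RV P >-> R}).
Hypothesis hB : two_sided_BM B.

Let X t w := B t w.

Lemma iid_increment t0 delta : 0 < delta ->
  iid P (increment X t0 delta) (normal_prob 0 (Num.sqrt delta)).
Proof.
move=> d0; split=> [i|n A mA].
  by apply: measurable_funB.
have hinc : increasing_seq (fun i : nat => t0 + i%:R * delta).
  by move=> m k; rewrite lerD2l ler_pM2r// ler_nat.
rewrite (BM_increments_independent hB n hinc mA).
apply: eq_bigr => i _.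
have lt : t0 + i%:R * delta < t0 + i.+1%:R * delta.
  by rewrite ltrD2l ltr_pM2r// ltr_nat.
rewrite (BM_increment_normal hB lt (mA i)).
have -> : t0 + i.+1%:R * delta - (t0 + i%:R * delta) = delta.
  by rewrite -natr1; ring.
by [].
Qed.

Lemma increment_mgf t0 delta i th : 0 < delta ->
  (\int[P]_w (expR (th * increment X t0 delta i w))%:E =
   (expR (th ^+ 2 * delta / 2))%:E)%E.
Proof.
move=> d0; have [mX law] := iid_increment t0 d0.
have mX' : @measurable_fun _ _ T (measurableTypeR R) setT
  (increment X t0 delta i) := mX i.
pose Y := @mfun_Sub _ _ T (measurableTypeR R) _ (mem_set mX').
have mf : measurable_fun setT (fun x : measurableTypeR R => (expR (th * x))%:E).
  by apply/measurable_EFinP; exact: measurableT_comp.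
have -> : (\int[P]_w (expR (th * increment X t0 delta i w))%:E =
    \int[@pushforward _ _ T (measurableTypeR R) R P Y]_x (expR (th * x))%:E)%E.
  by rewrite ge0_integral_pushforward.
transitivity (\int[normal_prob 0 (Num.sqrt delta)]_x (expR (th * x))%:E)%E.
  apply: eq_measure_integral => A mA _.
  have lt : t0 + i%:R * delta < t0 + i.+1%:R * delta.
    by rewrite ltrD2l ltr_pM2r// ltr_nat.
  have := BM_increment_normal hB lt mA.
  have -> : t0 + i.+1%:R * delta - (t0 + i%:R * delta) = delta.
    by rewrite -natr1; ring.
  exact.
rewrite normal_mgf; last by rewrite sqrtr_eq0 -ltNge.
by rewrite sqr_sqrtr// ltW.
Qed.

End brownian_increments.

(** * The supremum of Brownian motion with drift *)

(* What the maximal inequalities need of a Brownian motion; unlike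
   [two_sided_BM], visibly invariant under a change of sign. *)
Record gaussian_walks (R : realType) (d : measure_display)
    (T : measurableType d) (P : probability T R) (X : R -> T -> R) : Prop :=
  GaussianWalks {
  gw_measurable : forall t, measurable_fun setT (X t) ;
  gw_continuous : forall w, continuous (X ^~ w) ;
  gw_iid : forall t0 delta, 0 < delta ->
    exists nu, iid P (increment X t0 delta) nu ;
  gw_mgf : forall t0 delta th, 0 < delta ->
    (\int[P]_w (expR (th * increment X t0 delta 0 w))%:E =
     (expR (th ^+ 2 * delta / 2))%:E)%E
}.

Lemma BM_gaussian_walks (R : realType) (d : measure_display)
    (T : measurableType d) (P : probability T R) (B : R -> {RV P >-> R}) :
  two_sided_BM B -> gaussian_walks P (fun t w => B t w).
Proof.
move=> hB; split.
- by move=> t; exact: measurable_funPT.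
- exact: BM_continuous.
- by move=> t0 delta d0; exists (normal_prob 0 (Num.sqrt delta));
    exact: iid_increment.
- by move=> t0 delta th d0; exact: increment_mgf.
Qed.

Lemma gaussian_walks_opp (R : realType) (d : measure_display)
    (T : measurableType d) (P : probability T R) (X : R -> T -> R) :
  gaussian_walks P X -> gaussian_walks P (fun t w => - X t w).
Proof.
move=> [mX cX iX gX].
have E t0 delta i w : increment (fun t w => - X t w) t0 delta i w =
    - increment X t0 delta i w by rewrite /increment; ring.
split.
- by move=> t; exact: measurableT_comp.
- by move=> w t; apply: continuousN; exact: cX.
- move=> t0 delta d0; have [nu hnu] := iX t0 delta d0.
  exists (fun A => nu (-%R @^-1` A)).
  rewrite [X in iid _ X _](_ : _ = fun i w => - increment X t0 delta i w).
    by apply: (iid_map hnu); exact: oppr_measurable.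
  by apply/funext => i; apply/funext => w; exact: E.
- move=> t0 delta th d0.
  under eq_integral do rewrite E mulrN -mulNr.
  by rewrite gX// sqrrN.
Qed.

Lemma workload_gtP (R : realType) (T : Type) (c : R) (X : R -> T -> R) t w y :
  (y%:E < workload c X t w)%E <->
  exists2 s, t <= s & y < X s w - X t w - c * (s - t).
Proof.
split=> [/ereal_sup_gt[_ [s + <-]]|[s ts ys]].
  by rewrite /= in_itv/= andbT lte_fin => ? ?; exists s.
apply: (@lt_le_trans _ _ (X s w - X t w - c * (s - t))%:E).
  by rewrite lte_fin.
by apply: ereal_sup_ubound; exists s => //=; rewrite in_itv/= andbT.
Qed.

(** The mesh is a fraction of [S], so that [S] is a grid point at every level, with index [2 ^ m];
    time reversal at [S] then preserves the grid. The index is unbounded, so the grid covers the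
    half-line. *)
Definition dyadic (R : realType) (S : R) (m k : nat) : R := k%:R * (S / 2 ^+ m).

Lemma dyadic_ge0 (R : realType) (S : R) m k : 0 < S -> 0 <= dyadic S m k.
Proof. by move=> S0; rewrite mulr_ge0// divr_ge0// ltW. Qed.

Definition dyadic_floor (R : realType) (S : R) (m : nat) (t : R) : nat :=
  Num.truncn (t / (S / 2 ^+ m)).

Lemma dyadic_floor_itv (R : realType) (S : R) m t : 0 < S -> 0 <= t ->
  dyadic S m (dyadic_floor S m t) <= t < dyadic S m (dyadic_floor S m t) + S / 2 ^+ m.
Proof.
move=> S0 t0; rewrite /dyadic /dyadic_floor; set h := S / 2 ^+ m.
have h0 : 0 < h by rewrite divr_gt0// exprn_gt0.
have /andP[t1 t2] := truncn_itv (divr_ge0 t0 (ltW h0)).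
rewrite ler_pdivlMr// in t1; rewrite ltr_pdivrMr// -natr1 mulrDl mul1r in t2.
by rewrite t1 t2.
Qed.

Lemma expr2_unbounded (R : realType) (x : R) :
  exists N, forall m, (N <= m)%N -> x < 2 ^+ m.
Proof.
have [x0|x0] := leP 0 x; last first.
  by exists 0 => m _; rewrite (lt_trans x0)// exprn_gt0.
have /andP[_ xN] := truncn_itv x0.
exists (Num.truncn x).+1 => m Nm; apply: (lt_le_trans xN).
by rewrite -natrX ler_nat (leq_trans Nm)// ltnW// ltn_expl.
Qed.

Lemma dyadic_mesh (R : realType) (S e : R) : 0 < S -> 0 < e ->
  exists N, forall m, (N <= m)%N -> S / 2 ^+ m < e.
Proof.
move=> S0 e0; have [N HN] := expr2_unbounded (S / e); exists N => m /HN.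
by rewrite ltr_pdivrMr// => H; rewrite ltr_pdivrMr ?exprn_gt0// mulrC.
Qed.

Lemma dyadic_floor_near (R : realType) (S t : R) (O : set R) :
  0 < S -> 0 <= t -> nbhs t O ->
  exists N, forall m, (N <= m)%N -> O (dyadic S m (dyadic_floor S m t)).
Proof.
move=> S0 t0 /nbhs_ballP[e /= e0 eO].
have [N HN] := dyadic_mesh S0 e0; exists N => m /HN he.
have /andP[t1 t2] := dyadic_floor_itv m S0 t0.
by apply: eO; rewrite /ball/= ger0_norm ?subr_ge0//; lra.
Qed.

Lemma dyadic_refine (R : realType) (S : R) m n k :
  dyadic S m k = dyadic S (m + n) (k * 2 ^ n).
Proof.
rewrite /dyadic natrM natrX exprD.
have h : 2 ^+ n != 0 :> R by rewrite expf_neq0// pnatr_eq0.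
have h' : 2 ^+ m != 0 :> R by rewrite expf_neq0// pnatr_eq0.
by field; rewrite h h'.
Qed.

Section workload_law.
Context (R : realType) (d : measure_display) (T : measurableType d)
  (P : probability T R) (X : R -> T -> R) (c : R).
Hypotheses (hX : gaussian_walks P X) (c0 : 0 < c).

Let step t0 delta i w := increment X t0 delta i w - c * delta.

Lemma sum_step t0 delta k w : \sum_(i < k) step t0 delta i w =
  X (t0 + k%:R * delta) w - X t0 w - c * (k%:R * delta).
Proof.
rewrite sumrB sum_increment sumr_const card_ord -mulr_natl; ring.
Qed.

Lemma iid_step t0 delta : 0 < delta -> exists nu, iid P (step t0 delta) nu.
Proof.
move=> d0; have [nu hnu] := gw_iid hX t0 d0.
exists (fun A => nu ((fun x => x - c * delta) @^-1` A)).
by apply: (iid_map hnu (f := fun x => x - c * delta)); exact: measurable_funB.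
Qed.

Lemma step_mgf t0 delta th : 0 < delta ->
  (\int[P]_w (expR (th * step t0 delta 0 w))%:E =
   (expR (th ^+ 2 * delta / 2 - th * c * delta))%:E)%E.
Proof.
move=> d0.
rewrite addrC expRD EFinM -(gw_mgf hX t0 th d0) -ge0_integralZl; last 4 first.
- exact: measurableT.
- apply/measurable_EFinP; apply: measurableT_comp => //.
  apply: measurable_funM => //; have [nu [+ _]] := gw_iid hX t0 d0.
  exact.
- by move=> w _; rewrite lee_fin expR_ge0.
- by rewrite lee_fin expR_ge0.
apply: eq_integral => w _; rewrite -EFinM -expRD; congr (expR _)%:E.
by rewrite /step; ring.
Qed.

(** The inequality is strict, so by continuity a time exceeding the level can be moved to a nearby
    grid point. This makes the event a countable union. *)
Lemma workload_gt_dyadic S t w y : 0 < S -> (y%:E < workload c X t w)%E <->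
  exists m k, y < X (t + dyadic S m k) w - X t w - c * dyadic S m k.
Proof.
move=> S0; rewrite workload_gtP; split=> [[s ts ys]|[m [k mk]]]; last first.
  exists (t + dyadic S m k); first by rewrite lerDl dyadic_ge0.
  by rewrite (addrAC t) subrr add0r.
pose f r := X (t + r) w - X t w - c * r.
have cf : {for s - t, continuous f}.
  apply: continuousB; last by apply: continuousM; [exact: cst_continuous|].
  apply: continuousB; last exact: cst_continuous.
  apply: (@continuous_comp _ _ _ (fun r => t + r) (X ^~ w)).
    by apply: continuousD; [exact: cst_continuous|].
  exact: (gw_continuous hX).
have yf : y < f (s - t) by rewrite /f [t + _]addrC subrK.
have st0 : 0 <= s - t by rewrite subr_ge0.
have [N HN] := dyadic_floor_near S0 st0 (cvgr_gt _ cf _ yf).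
by exists N; eexists; exact: (HN N).
Qed.

Lemma measurable_workload_gt t y :
  measurable [set w | (y%:E < workload c X t w)%E].
Proof.
have -> : [set w | (y%:E < workload c X t w)%E] = \bigcup_m \bigcup_k
    [set w | y < X (t + dyadic 1 m k) w - X t w - c * dyadic 1 m k].
  apply/seteqP; split => w /=.
    by move/(workload_gt_dyadic _ _ _ (ltr01 : 0 < 1 :> R)) => [m [k H]];
      exists m => //; exists k.
  move=> [m _ [k _ H]]; apply/(workload_gt_dyadic _ _ _ (ltr01 : 0 < 1 :> R)).
  by exists m, k.
apply: bigcupT_measurable => m; apply: bigcupT_measurable => k.
apply: measurable_lt_set => //; apply: measurable_funB => //.
by apply: measurable_funB; exact: (gw_measurable hX).
Qed.

Lemma measurable_workload t : measurable_fun setT (workload c X t).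
Proof.
apply: (measurability _ (ErealGenOInfty.measurableE R)) => _ [_ [y ->] <-].
rewrite setTI (_ : _ @^-1` _ = [set w | (y%:E < workload c X t w)%E]).
  exact: measurable_workload_gt.
by apply/seteqP; split => w /=; rewrite in_itv/= andbT.
Qed.

Lemma passage_sub_workload delta n t y : 0 < delta ->
  passage (step t delta) n y `<=` [set w | (y%:E < workload c X t w)%E].
Proof.
move=> d0 w [k _]; rewrite sum_step => H; apply/workload_gtP.
exists (t + k%:R * delta); first by rewrite lerDl mulr_ge0// ltW.
by rewrite [t + _ - t](addrAC t) subrr add0r.
Qed.

Lemma workload_le t y :
  (P [set w | (y%:E < workload c X t w)%E] <= (expR (- (2 * c * y)))%:E)%E.
Proof.
(* With mesh [2^-m], [4^m] steps reach time [2^m]: both the resolution and the horizon grow, so the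
   events increase to the exceedance event. *)
pose F m := passage (step t (1 / 2 ^+ m)) (4 ^ m) y.
have d0 m : 0 < 1 / 2 ^+ m :> R by rewrite divr_gt0// exprn_gt0.
have mF m : measurable (F m).
  have [nu hnu] := iid_step t (d0 m).
  by apply: measurable_passage => //; exact: hnu.1.
have FE m w : F m w <-> exists2 k, (k <= 4 ^ m)%N &
    y < X (t + dyadic 1 m k) w - X t w - c * dyadic 1 m k.
  by rewrite /F /passage /=; split => -[k kn]; rewrite ?sum_step => H;
    exists k => //; rewrite sum_step.
have UF : [set w | (y%:E < workload c X t w)%E] = \bigcup_m F m.
  apply/seteqP; split => w /=; last first.
    by move=> [m _]; exact: passage_sub_workload.
  move=> /(workload_gt_dyadic _ _ _ (ltr01 : 0 < 1 :> R)) [m [k H]].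
  (* At level [m + k] the refined index [k 2^k] is within the allowed [4^(m + k)] steps. *)
  exists (m + k)%N => //; apply/FE; exists (k * 2 ^ k)%N; last first.
    by rewrite -dyadic_refine.
  rewrite expnD -[(4 ^ k)%N]/((2 * 2) ^ k)%N expnMn.
  rewrite (leq_trans _ (leq_pmull _ _)) ?expn_gt0// leq_mul//.
  by rewrite ltnW// ltn_expl.
have ndF : nondecreasing_seq F.
  move=> m n mn; apply/subsetPset => w /FE[k km H]; apply/FE.
  exists (k * 2 ^ (n - m))%N; last first.
    by have := dyadic_refine 1 m (n - m) k; rewrite subnKC// => <-.
  rewrite -{2}(subnKC mn) expnD leq_mul//.
  by case: (n - m)%N => // e; rewrite leq_exp2r.
rewrite UF.
have cv := nondecreasing_cvg_mu (mu := P) mF (bigcupT_measurable _ mF) ndF.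
rewrite -(cvg_lim _ cv)//; apply: lime_le; first by apply/cvg_ex; eexists; exact: cv.
apply: nearW => m /=; have [nu hnu] := iid_step t (d0 m).
have -> : - (2 * c * y) = - (2 * c) * y by ring.
apply: (passage_le hnu); first by rewrite mulr_ge0// ltW.
rewrite step_mgf// lee_fin -[leRHS]expR0 ler_expR.
have -> : (2 * c) ^+ 2 * (1 / 2 ^+ m) / 2 - 2 * c * c * (1 / 2 ^+ m) = 0.
  by field; rewrite expf_neq0// pnatr_eq0.
by [].
Qed.

End workload_law.

(** From [e^(x/k) >= 1 + x/k >= x/k], raised to the power [k]. *)
Lemma expRN_le_exprV (R : realType) (k : nat) (x : R) : (0 < k)%N -> 0 < x ->
  expR (- x) <= (k%:R / x) ^+ k.
Proof.
move=> k0 x0; have kR : 0 < k%:R :> R by rewrite ltr0n.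
rewrite expRN -[leRHS]invrK lef_pV2 ?posrE ?expR_gt0 ?invr_gt0 ?exprn_gt0 ?divr_gt0//.
rewrite -exprVn invf_div.
have -> : x = k%:R * (x / k%:R) by rewrite mulrC divfK ?gt_eqF.
rewrite expRM_natl mulrAC mulfV ?gt_eqF// mul1r.
have xk0 : 0 <= x / k%:R by rewrite divr_ge0// ltW.
rewrite lerXn2r ?nnegrE ?expR_ge0//.
by apply: le_trans (expR_ge1Dx _); rewrite lerDr.
Qed.

Section workload_exponential.
Context (R : realType) (d : measure_display) (T : measurableType d)
  (P : probability T R) (X : R -> T -> R) (c : R).
Hypotheses (hX : gaussian_walks P X) (c0 : 0 < c).

(** One integer [j] drives all parameters of [passage_ge]: mesh [4^-j], [th = 2^j], and [16^j]
    steps. Then [th^2 delta = 1] keeps the third moment below [e^(1/2)], the horizon [4^j] makes the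
    surviving mass small, and the overshoot error [16^j e^(-2^j eps)] still vanishes. *)
Let mesh_bound t y eps j : 0 <= y -> 0 < eps -> 2 * c <= 2 ^+ j ->
  expR (- (2 * c * (y + eps))) <= fine (P [set w | (y%:E < workload c X t w)%E]) +
    ((5%:R / eps) ^+ 5 * expR (1 / 2) + 2 / c ^+ 2) / 2 ^+ j.
Proof.
move=> y0 eps0 cj; pose delta : R := 1 / 4 ^+ j.
have z0 : 0 < 2 ^+ j :> R by rewrite exprn_gt0.
have f4 : 4 ^+ j = 2 ^+ j * 2 ^+ j :> R by rewrite -exprMn -natrM.
have d0 : 0 < delta by rewrite divr_gt0// exprn_gt0.
have [nu hnu] := iid_step c hX t d0.
have mg th := step_mgf c hX t th d0.
have := @passage_ge _ _ _ _ _ _ hnu c eps (2 ^+ j) (expR (- (c ^+ 2 * delta / 2)))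
  (expR (1 / 2)) (16 ^ j) y c0 (ltW eps0) cj (expR_ge0 _) (expR_ge0 _).
have e1 : (\int[P]_w (expR (2 * c * (increment X t delta 0 w - c * delta)))%:E = 1)%E.
  by rewrite mg (_ : _ - _ = 0) ?expR0//; field.
have e2 : (\int[P]_w (expR (c * (increment X t delta 0 w - c * delta)))%:E <=
    (expR (- (c ^+ 2 * delta / 2)))%:E)%E.
  by rewrite mg (_ : _ - _ = - (c ^+ 2 * delta / 2))//; field.
have e3 : (\int[P]_w (expR (2 ^+ j * (increment X t delta 0 w - c * delta)))%:E <=
    (expR (1 / 2))%:E)%E.
  rewrite mg lee_fin ler_expR /delta f4 expr2 mulrCA mul1r.
  rewrite [leLHS](_ : _ = 1 / 2 - c / 2 ^+ j); last by field; rewrite gt_eqF.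
  by rewrite lerBlDr lerDl divr_ge0// ltW.
move=> /(_ e1 e2 e3).
set p := P (passage _ _ _) => H.
have : (p <= P [set w | (y%:E < workload c X t w)%E])%E.
  have mW : measurable [set w | (y%:E < workload c X t w)%E].
    exact: measurable_workload_gt hX _ _.
  apply: le_measure; rewrite ?inE//; last exact: passage_sub_workload.
  by apply: measurable_passage => //; exact: hnu.1.
move: H; rewrite (min_idPr _); last first.
  rewrite -[leRHS]expR0 ler_expR oppr_le0.
  by apply: mulr_ge0; [rewrite mulr_ge0// ltW|rewrite addr_ge0// ltW].
move=> H pP; move: (le_trans H (leeD2r _ pP)).
rewrite -[P [set w | _]]fineK ?fin_num_measure//; last exact: measurable_workload_gt hX _ _.
rewrite -EFinD lee_fin => /le_trans; apply; rewrite lerD2l mulrDl lerD//.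
  rewrite mulrA [leRHS]mulrAC ler_wpM2r ?expR_ge0//.
  (* The number of steps is [(2^j)^4], so the power 5 leaves a factor [2^-j]. *)
  have h5 : expR (- (2 ^+ j * eps)) <= (5%:R / (2 ^+ j * eps)) ^+ 5.
    by apply: expRN_le_exprV => //; rewrite mulr_gt0.
  apply: (@le_trans _ _ ((16 ^ j)%N%:R * (5%:R / (2 ^+ j * eps)) ^+ 5)).
    by rewrite ler_wpM2l.
  have -> : (16 ^ j)%N%:R = (2 ^+ j) ^+ 4 :> R.
    by rewrite natrX -[16%N]/(2 ^ 4)%N natrX -!exprM mulnC.
  rewrite le_eqVlt; apply/orP; left; apply/eqP.
  by field; rewrite !gt_eqF.
have b16 : expR (- (c ^+ 2 * delta / 2)) ^+ (16 ^ j) =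
    expR (- (c ^+ 2 * 4 ^+ j / 2)).
  rewrite -expRM_natl natrX -[16%N]/(4 * 4)%N natrM exprMn.
  congr expR; rewrite /delta; field.
  by rewrite expf_neq0// pnatr_eq0.
rewrite b16.
apply: (@le_trans _ _ (expR (- (c ^+ 2 * 4 ^+ j / 2)))).
  by rewrite ler_piMl ?expR_ge0// -[leRHS]expR0 ler_expR oppr_le0 mulr_ge0// ltW.
have x0 : 0 < c ^+ 2 * 4 ^+ j / 2 by rewrite !mulr_gt0// ?exprn_gt0.
apply: (le_trans (expRN_le_exprV (ltn0Sn 0) x0)).
rewrite expr1 f4 [leLHS](_ : _ = 2 / c ^+ 2 / 2 ^+ j / 2 ^+ j); last first.
  by field; rewrite !gt_eqF.
rewrite ler_pdivrMr// ler_peMr ?exprn_ege1 ?ler1n//.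
by rewrite !divr_ge0// ?exprn_ge0// ltW.
Qed.

Lemma workload_gtE t y : 0 <= y ->
  P [set w | (y%:E < workload c X t w)%E] = (expR (- (2 * c * y)))%:E.
Proof.
move=> y0; apply/eqP; rewrite eq_le workload_le//=.
set p := P _.
have pfin : p \is a fin_num.
  by rewrite fin_num_measure//; exact: measurable_workload_gt hX _ _.
rewrite -(fineK pfin) lee_fin.
(* Here [j] tends to infinity with [eps] fixed; [eps] is sent to 0 afterwards. *)
have H eps : 0 < eps -> expR (- (2 * c * (y + eps))) <= fine p.
  move=> eps0; set K := (5%:R / eps) ^+ 5 * expR (1 / 2) + 2 / c ^+ 2.
  have K0 : 0 < K.
    apply: addr_gt0; last by rewrite divr_gt0// exprn_gt0.
    by apply: mulr_gt0; [rewrite exprn_gt0// divr_gt0|exact: expR_gt0].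
  apply/ler_addgt0Pr => e e0.
  have [N1 HN1] := expr2_unbounded (K / e).
  have [N2 HN2] := expr2_unbounded (2 * c).
  have := mesh_bound t y0 eps0 (ltW (HN2 _ (leq_maxr N1 N2))).
  move=> /le_trans; apply; rewrite lerD2l.
  rewrite ler_pdivrMr ?exprn_gt0// [e * _]mulrC -ler_pdivrMr//.
  exact: ltW (HN1 _ (leq_maxl _ _)).
apply/ler_addgt0Pr => e e0.
pose q := expR (- (2 * c * y)); have q0 : 0 < q by exact: expR_gt0.
(* With [e^(-2 c eps) >= 1 - 2 c eps], the loss [2 c eps q] is then exactly [e]. *)
pose eps := e / (2 * c * q).
have eps0 : 0 < eps by rewrite divr_gt0// !mulr_gt0.
have := H eps eps0; rewrite mulrDr opprD expRD -/q => Hq.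
have : q * (1 - 2 * c * eps) <= q * expR (- (2 * c * eps)).
  by rewrite ler_pM2l//; exact: expR_ge1Dx.
have -> : q * (1 - 2 * c * eps) = q - e.
  by rewrite /eps; field; rewrite !gt_eqF.
by move: Hq; lra.
Qed.

End workload_exponential.

(** * Reversal of the path at time [S] *)

Section time_reversal.
Context (R : realType) (d : measure_display) (T : measurableType d)
  (P : probability T R) (X : R -> T -> R) (S : R).
Hypotheses (hX : gaussian_walks P X) (S0 : 0 < S).

Definition forward (i : nat * nat) (w : T) : R := X (dyadic S i.1 i.2) w - X 0 w.

(** Up to [S], the first path read backwards from [S]; after [S], the increments of an independent
    second copy. Its increments at level [m] are the sequence of [iid_cat] with [k = 2 ^ m]. *)
Definition reversed (i : nat * nat) (w : T * T) : R :=
  if (i.2 <= 2 ^ i.1)%N then X S w.1 - X (S - dyadic S i.1 i.2) w.1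
  else X S w.1 - X 0 w.1 + (X (dyadic S i.1 i.2 - S) w.2 - X 0 w.2).

Let dyadicS m : dyadic S m (2 ^ m) = S.
Proof.
by rewrite /dyadic natrX mulrC divfK// expf_neq0// pnatr_eq0.
Qed.

Let eta m := increment X 0 (S / 2 ^+ m).

Let eta' m i (w : T * T) := if (i < 2 ^ m)%N then eta m ((2 ^ m).-1 - i) w.1
  else eta m (i - 2 ^ m) w.2.

Let sum_eta m k w : \sum_(l < k) eta m l w = forward (m, k) w.
Proof. by rewrite sum_increment add0r. Qed.

Let sum_eta' m k w : \sum_(l < k) eta' m l w = reversed (m, k) w.
Proof.
have low n : (n <= 2 ^ m)%N -> \sum_(l < n) eta' m l w =
    X S w.1 - X (S - dyadic S m n) w.1.
  elim: n => [|n IH] nm.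
    by rewrite big_ord0 /dyadic mul0r subr0 subrr.
  rewrite big_ord_recr /= IH ?(ltnW nm)// /eta' nm /eta /increment.
  have -> : ((2 ^ m).-1 - n).+1 = (2 ^ m - n)%N by lia.
  have -> : ((2 ^ m).-1 - n)%N = (2 ^ m - n.+1)%N by lia.
  have E j : (j <= 2 ^ m)%N -> 0 + (2 ^ m - j)%:R * (S / 2 ^+ m) = S - dyadic S m j.
    by move=> jm; rewrite natrB// add0r mulrBl; congr (_ - _); exact: dyadicS.
  by rewrite !E ?(ltnW nm)//; ring.
rewrite /reversed /=; case: leqP => [|mk]; first exact: low.
rewrite -(subnKC (ltnW mk)) big_split_ord /= low// dyadicS subrr; congr (_ + _).
rewrite (eq_bigr (fun l : 'I__ => eta m l w.2)); last first.
  by move=> l _; rewrite /eta' ltnNge leq_addr /= addKn.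
rewrite sum_increment add0r; congr (X _ _ - _).
rewrite subnKC ?(ltnW mk)// natrB ?(ltnW mk)// mulrBl; congr (_ - _).
exact: dyadicS.
Qed.

Lemma measurable_forward i : measurable_fun setT (forward i).
Proof. by apply: measurable_funB; exact: (gw_measurable hX). Qed.

Lemma measurable_reversed i : measurable_fun setT (reversed i).
Proof.
have m1 t : measurable_fun setT (fun w : T * T => X t w.1).
  by apply: measurableT_comp => //; exact: (gw_measurable hX).
have m2 t : measurable_fun setT (fun w : T * T => X t w.2).
  by apply: measurableT_comp => //; exact: (gw_measurable hX).
rewrite /reversed; case: leqP => _; first exact: measurable_funB.
by apply: measurable_funD; exact: measurable_funB.
Qed.

(** Finitely many grid times share a refinement level, where both processes are the same partial
    sums of i.i.d. sequences with a common law. *)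
Lemma forward_reversed_law (G : set (path_space (nat * nat) R)) : measurable G ->
  P [set w | G (fun i => forward i w)] =
  (P \x P)%E [set w | G (fun i => reversed i w)].
Proof.
move=> mG; apply: (eq_law_path (m2 := (P \x P)%E)) => //.
- exact: measurable_forward.
- exact: measurable_reversed.
move=> n t A mA.
pose m := (\max_i (t i).1)%N.
pose K i := ((t i).2 * 2 ^ (m - (t i).1))%N.
have tm i : ((t i).1 <= m)%N by exact: (leq_bigmax (F := fun i => (t i).1)).
have dK i : dyadic S (t i).1 (t i).2 = dyadic S m (K i).
  by rewrite (dyadic_refine _ _ (m - (t i).1)) subnKC.
have fK i w : forward (t i) w = \sum_(l < K i) eta m l w.
  by rewrite sum_eta /forward dK.
have rK i w : reversed (t i) w = \sum_(l < K i) eta' m l w.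
  rewrite sum_eta' /reversed dK /=; congr (if _ then _ else _).
  rewrite /K -[in RHS](subnKC (tm i)) expnD addKn leq_pmul2r// expn_gt0.
  by [].
pose G' : set (path_space nat R) := [set f : nat -> R | forall i, A i (\sum_(l < K i) f l)].
have mG' : measurable G'.
  have -> : G' = \bigcap_(i in [set: 'I_n])
      (fun f : path_space nat R => \sum_(l < K i) f l) @^-1` A i.
    by apply/seteqP; split => f /= h i; [move=> _; exact: h|exact: h].
  apply: fin_bigcap_measurable => // i _; rewrite -[X in measurable X]setTI.
  by apply: measurable_sum => // l; exact: measurable_coord.
have d0 : 0 < S / 2 ^+ m by rewrite divr_gt0// exprn_gt0.
have [nu hnu] := gw_iid hX 0 d0.
have -> : [set w | forall i, A i (forward (t i) w)] =
    [set w | G' (fun i => eta m i w)].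
  by apply/seteqP; split => w /= h i; [rewrite -fK|rewrite fK]; exact: h.
have -> : [set w | forall i, A i (reversed (t i) w)] =
    [set w | G' (fun i => eta' m i w)].
  by apply/seteqP; split => w /= h i; [rewrite -rK|rewrite rK]; exact: h.
exact: iid_law hnu (iid_cat hnu hnu (2 ^ m)) _ mG'.
Qed.

End time_reversal.

(** * Sojourn times of continuous paths *)

Section occupation.
Context (R : realType) (S T1 T2 : R).
Hypotheses (S0 : 0 < S) (T10 : 0 <= T1).

(* For a continuous [f] this is [{t | y < f t}], but only the values of [f] on
   the dyadic grid are used, so that it is determined by countably many
   coordinates of the path. *)
Definition dyadic_superlevel (f : nat * nat -> \bar R) (y : R) : set R :=
  [set t | exists j, forall N, exists2 m, (N <= m)%N &
     ((y + j.+1%:R^-1)%:E < f (m, dyadic_floor S m t))%E].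

Definition occupation (f : nat * nat -> \bar R) (y : R) : \bar R :=
  lebesgue_measure (`[T1, T2] `&` dyadic_superlevel f y).

Lemma dyadic_floorP m t k : 0 <= t -> dyadic_floor S m t = k <->
  t \in `[dyadic S m k, dyadic S m k + S / 2 ^+ m[.
Proof.
move=> t0; have h0 : 0 < S / 2 ^+ m by rewrite divr_gt0// exprn_gt0.
split=> [<-|]; first by rewrite in_itv/=; exact: dyadic_floor_itv.
rewrite in_itv/= /dyadic => /andP[t1 t2]; rewrite /dyadic_floor.
apply: truncn_def; rewrite ler_pdivlMr// t1 ltr_pdivrMr//.
by rewrite -natr1 mulrDl mul1r.
Qed.

Section measurability.
Context (d : measure_display) (U : measurableType d)
  (F : nat * nat -> U -> \bar R) (v : U -> R).
Hypotheses (mF : forall i, measurable_fun setT (F i))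
  (mv : measurable_fun setT v).

Let graph := [set z : U * R | z.2 \in `[T1, T2] /\
  dyadic_superlevel (fun i => F i z.1) (v z.1) z.2].

(** [dyadic_floor] is constant on grid cells, so the graph is a countable combination of rectangles.
    Joint measurability then yields that of its sections and of their lengths. *)
Let measurable_graph : measurable graph.
Proof.
have -> : graph = \bigcup_j \bigcap_N \bigcup_(m in [set m | (N <= m)%N])
   \bigcup_k ([set w | ((v w + j.+1%:R^-1)%:E < F (m, k) w)%E] `*`
     (`[T1, T2] `&` `[dyadic S m k, dyadic S m k + S / 2 ^+ m[)).
  apply/seteqP; split => -[w t] /=.
    move=> [tT [j Hj]]; exists j => // N _; have [m Nm H] := Hj N.
    exists m => //; exists (dyadic_floor S m t) => //; split => //; split => //.
    have t0 : 0 <= t by rewrite (le_trans T10)//; move: tT; rewrite in_itv/= => /andP[].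
    by apply/(dyadic_floorP m _ t0).
  move=> [j _ Hj]; split.
    by have [m _ [k _ [_ []]]] := Hj 0 I.
  exists j => N; have [m Nm [k _ [/= H [tT tk]]]] := Hj N I; exists m => //.
  have t0 : 0 <= t by rewrite (le_trans T10)//; move: tT; rewrite in_itv/= => /andP[].
  by rewrite (_ : dyadic_floor S m t = k)//; apply/(dyadic_floorP m k t0).
apply: bigcupT_measurable => j; apply: bigcapT_measurable => N.
apply: bigcup_measurable => m _; apply: bigcupT_measurable => k.
apply: measurableX; last by apply: measurableI; exact: measurable_itv.
rewrite -[X in measurable X]setTI; apply: measurable_lte => //.
by apply/measurable_EFinP; exact: measurable_funD.
Qed.

Let graph_section w :
  xsection graph w = `[T1, T2] `&` dyadic_superlevel (fun i => F i w) (v w).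
Proof. by apply/seteqP; split => t; rewrite /xsection /= inE. Qed.

Lemma measurable_superlevel_section w :
  measurable (`[T1, T2] `&` dyadic_superlevel (fun i => F i w) (v w)).
Proof. by rewrite -graph_section; exact: measurable_xsection. Qed.

Lemma measurable_occupation :
  measurable_fun setT (fun w => occupation (fun i => F i w) (v w)).
Proof.
rewrite [X in measurable_fun _ X](_ : _ = lebesgue_measure \o xsection graph).
  exact: measurable_fun_xsection.
by apply/funext => w /=; rewrite graph_section.
Qed.

Lemma measurable_long_occupation (x : R) :
  measurable [set w | (x%:E < occupation (fun i => F i w) (v w))%E].
Proof.
rewrite -[X in measurable X]setTI; apply: measurable_lte => //.
exact: measurable_occupation.
Qed.

End measurability.

Lemma measurable_superlevel f y :
  measurable (`[T1, T2] `&` dyadic_superlevel f y).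
Proof.
(* A deterministic path is viewed as a random one over the dummy space [nat]. *)
apply: (@measurable_superlevel_section _ nat (fun i _ => f i) (fun=> y) _ _ 0) => //.
Qed.

Lemma occupation_fin_num f y : T1 <= T2 -> occupation f y \is a fin_num.
Proof.
move=> T12; rewrite ge0_fin_numE//.
apply: (@le_lt_trans _ _ (lebesgue_measure `[T1, T2])).
  by apply: le_measure; rewrite ?inE//; exact: measurable_superlevel.
by rewrite lebesgue_measure_itv/=; case: ifP => // _; rewrite -EFinD ltry.
Qed.

(** The margin [1/(j+1)] keeps the inequality strict in the limit: if [f t <= y], the grid values
    near [t] end up below [y + 1/(j+1)]. *)
Lemma dyadic_superlevel_continuous (f : R -> R) y t :
  {within `[0, +oo[, continuous f} -> 0 <= t ->
  dyadic_superlevel (fun i => (f (dyadic S i.1 i.2))%:E) y t <-> y < f t.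
Proof.
move=> /subspace_continuousP cf t0.
have cft : f @ within `[0, +oo[ (nbhs t) --> f t.
  by apply: cf; rewrite /= in_itv/= t0.
have near (Q : R -> Prop) : (\forall s \near f t, Q s) ->
    exists N, forall m, (N <= m)%N -> Q (f (dyadic S m (dyadic_floor S m t))).
  move=> /cft; rewrite /fmap/= /within/= => H.
  have [N HN] := dyadic_floor_near S0 t0 H; exists N => m Nm.
  by apply: HN => //=; rewrite in_itv/= andbT dyadic_ge0.
split=> [[j Hj]|yft].
  rewrite ltNge; apply/negP => fty.
  have : \forall s \near f t, s < y + j.+1%:R^-1.
    by apply: lt_nbhsl; rewrite (le_lt_trans fty)// ltrDl invr_gt0.
  move=> /near[N HN]; have [m Nm] := Hj N; rewrite lte_fin => /lt_trans.
  by move=> /(_ _ (HN m Nm)); rewrite ltxx.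
have [j jy] : exists j, y + j.+1%:R^-1 < f t.
  have d0 : 0 < f t - y by rewrite subr_gt0.
  have i0 : 0 <= (f t - y)^-1 by rewrite invr_ge0 ltW.
  exists (Num.truncn (f t - y)^-1); rewrite -ltrBrDl.
  have /andP[_] := truncn_itv i0.
  by rewrite invf_plt ?posrE// ltr0n.
exists j => N.
have : \forall s \near f t, y + j.+1%:R^-1 < s by exact: lt_nbhsr.
move=> /near[N' HN]; exists (maxn N N'); first exact: leq_maxl.
by rewrite lte_fin; apply: HN; exact: leq_maxr.
Qed.

Lemma superlevel_continuous (f : R -> R) y :
  {within `[0, +oo[, continuous f} ->
  `[T1, T2] `&` dyadic_superlevel (fun i => (f (dyadic S i.1 i.2))%:E) y =
  `[T1, T2] `&` [set t | y < f t].
Proof.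
move=> cf; have t0 t : t \in `[T1, T2] -> 0 <= t.
  by rewrite in_itv/= => /andP[T1t _]; exact: le_trans T1t.
by apply/seteqP; split => t [tT H]; split => //;
  apply/(dyadic_superlevel_continuous y cf (t0 t tT)).
Qed.

Lemma sojournE (f : R -> R) y : T1 <= T2 ->
  {within `[0, +oo[, continuous f} ->
  (sojourn T1 T2 y f)%:E = lebesgue_measure (`[T1, T2] `&` [set t | y < f t]).
Proof.
move=> T12 cf; rewrite /sojourn /Rintegral -superlevel_continuous//.
rewrite -[RHS]fineK ?occupation_fin_num//; congr (fine _)%:E.
transitivity (\int[lebesgue_measure]_(t in `[T1, T2])
    (\1_(`[T1, T2] `&` [set t | y < f t]) t)%:E)%E; last first.
  rewrite integral_indic//; last first.
    by rewrite -superlevel_continuous//; exact: measurable_superlevel.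
  by rewrite -superlevel_continuous// setIC setIA setIid.
by apply: eq_integral => t tT; rewrite !indicE in_setI tT.
Qed.

Lemma sojourn_occupation (f : R -> R) y : T1 <= T2 ->
  {within `[0, +oo[, continuous f} ->
  (sojourn T1 T2 y f)%:E = occupation (fun i => (f (dyadic S i.1 i.2))%:E) y.
Proof. by move=> T12 cf; rewrite sojournE// /occupation superlevel_continuous. Qed.

(** Only levels strictly above [y] and grid times up to [T2] are compared, which is why pathwise
    identities valid only at high levels can be used. *)
Lemma eq_occupation (f g : nat * nat -> \bar R) y :
  (forall i y', 0 <= dyadic S i.1 i.2 <= T2 -> y < y' ->
     (y'%:E < f i)%E <-> (y'%:E < g i)%E) ->
  occupation f y = occupation g y.
Proof.
have sub (f1 g1 : nat * nat -> \bar R) : (forall i y', 0 <= dyadic S i.1 i.2 <= T2 ->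
    y < y' -> (y'%:E < f1 i)%E -> (y'%:E < g1 i)%E) ->
    `[T1, T2] `&` dyadic_superlevel f1 y `<=` `[T1, T2] `&` dyadic_superlevel g1 y.
  move=> fg t [/= tT [j Hj]]; split => //; exists j => N.
  have [m Nm ym] := Hj N; exists m => //; apply: fg ym; last first.
    by rewrite ltrDl invr_gt0.
  move: tT; rewrite in_itv/= => /andP[T1t tT2].
  have /andP[H _] := dyadic_floor_itv m S0 (le_trans T10 T1t).
  by rewrite dyadic_ge0//= (le_trans H).
move=> fg; rewrite /occupation; congr lebesgue_measure.
by apply/seteqP; split; apply: sub => i y' iT /fg -/(_ _ iT) [].
Qed.

End occupation.

Lemma lebesgue_measure_reflect (R : realType) (a : R) (A : set R) :
  measurable A ->
  lebesgue_measure ((fun t : R => a - t) @^-1` A) = lebesgue_measure A.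
Proof.
move=> mA.
have mr : @measurable_fun _ _ (measurableTypeR R) (measurableTypeR R) setT
  (fun t : R => a - t) by exact: measurable_funB.
pose r := @mfun_Sub _ _ (measurableTypeR R) (measurableTypeR R) _ (mem_set mr).
apply/esym; apply: (lebesgue_measure_unique
  (mu := pushforward lebesgue_measure r)) => //= _ [[u v]] _ <-.
rewrite /pushforward.
have -> : r @^-1` `]u, v]%classic = `[a - v, a - u[%classic.
  by apply/seteqP; split => t /=; rewrite !in_itv/=; lra.
rewrite !lebesgue_measure_itv/= !lte_fin ltrD2l ltrN2.
by case: ifP => // _; rewrite -!EFinD; congr EFin; ring.
Qed.

(** The level may be random so that it can be a coordinate of [R * T], giving joint measurability in
    level and path. *)
Lemma measurable_sojourn_gt (R : realType) (d : measure_display)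
    (U : measurableType d) (T1 T2 x : R) (Z : R -> U -> R) (v : U -> R) :
  0 <= T1 -> T1 <= T2 -> (forall t, measurable_fun setT (Z t)) ->
  (forall w, continuous (Z ^~ w)) -> measurable_fun setT v ->
  measurable [set w | x < sojourn T1 T2 (v w) (fun t => Z t w)].
Proof.
move=> T10 T12 mZ cZ mv.
rewrite (_ : [set w | _] = [set w | (x%:E < occupation 1 T1 T2
    (fun i => (Z (dyadic 1 i.1 i.2) w)%:E) (v w))%E]); last first.
  apply/seteqP; split => w /=;
    rewrite -(sojourn_occupation ltr01 T10 (f := fun t => Z t w) (v w) T12) ?lte_fin//;
    by apply: continuous_subspaceT; exact: cZ.
apply: (measurable_long_occupation T2 ltr01 T10
  (F := fun i w => (Z (dyadic 1 i.1 i.2) w)%:E)) => // i.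
exact/measurable_EFinP.
Qed.

Lemma eq_ereal_gtP (R : realType) (a b : \bar R) :
  (forall y : R, (y%:E < a)%E <-> (y%:E < b)%E) -> a = b.
Proof.
have le (e f : \bar R) : (forall y : R, (y%:E < e)%E -> (y%:E < f)%E) -> (e <= f)%E.
  move=> H; rewrite leNgt; apply/negP => fe.
  have [f_fin|] := boolP (f \is a fin_num).
    by have := H (fine f); rewrite fineK// ltxx => /(_ fe).
  move: fe H; case: f => [r| |]// fe H _; first by move: fe; rewrite ltNge leey.
  case: e fe H => [r| |]// _ H.
    by have := H (r - 1); rewrite lte_fin ltrBlDr ltrDl ltr01 ltNge leNye => /(_ isT).
  by have := H 0; rewrite ltry ltNge leNye => /(_ isT).
by move=> H; apply/eqP; rewrite eq_le !le// => y /H.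
Qed.

(** * Transfer of queue events to the workload of [B] *)

Section queue_transfer.
Context (R : realType) (d d' : measure_display) (T : measurableType d)
  (P : probability T R) (T' : measurableType d') (P' : probability T' R)
  (B : R -> {RV P >-> R}) (Q : R -> {RV P' >-> R}) (c S T1 T2 : R).
Hypotheses (hB : two_sided_BM B) (hQ : stationary_queue c B Q) (S0 : 0 < S)
  (T10 : 0 <= T1) (T12 : T1 <= T2).

Let X t w := B t w.
Let hX : gaussian_walks P X := BM_gaussian_walks hB.

Lemma queue_event_law x y u :
  P' ([set w | x < sojourn T1 T2 y (fun t => Q t w)] `&` [set w | u < Q 0 w]) =
  P [set w |
    (x%:E < occupation S T1 T2 (fun i => workload c X (dyadic S i.1 i.2) w) y)%E /\
    (u%:E < workload c X 0 w)%E].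
Proof.
(* The coordinate [(0, 0)] is time 0, so the conditioning event is also read on the grid. *)
pose G : set (path_space (nat * nat) (\bar R)) := [set f : nat * nat -> \bar R |
  (x%:E < occupation S T1 T2 f y)%E /\ (u%:E < f (0%N, 0%N))%E].
have mG : measurable G.
  apply: measurableI.
    apply: (measurable_long_occupation T2 S0 T10 (v := fun=> y)) => //.
    exact: measurable_coord.
  rewrite -[X in measurable X]setTI; apply: measurable_lte => //.
  exact: measurable_coord.
have cQ w : {within `[0, +oo[, continuous (fun t => Q t w)}.
  exact: (queue_continuous hQ).
have d00 : dyadic S 0%N 0%N = 0 by rewrite /dyadic mul0r.
have := @eq_law_path (nat * nat)%type R _ (\bar R) _ _ _ _ P' P
  (fun i w => (Q (dyadic S i.1 i.2) w)%:E)
  (fun i w => workload c X (dyadic S i.1 i.2) w).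
move=> /(_ _ _ _ G mG); rewrite /G /= d00 => <-.
- congr (P' _); apply/seteqP; split => w /=;
    by rewrite -(sojourn_occupation S0 T10 (f := fun t => Q t w) y T12
      (cQ w)) !lte_fin.
- by move=> i; apply/measurable_EFinP; exact: measurable_funPT.
- by move=> i; exact: measurable_workload hX _.
- move=> n t A mA; apply: (queue_law hQ (t := fun i => dyadic S (t i).1 (t i).2)) => //.
  by move=> i; exact: dyadic_ge0.
Qed.

Lemma queue0_law u : 0 < c -> 0 <= u ->
  P' [set w | u < Q 0 w] = (expR (- (2 * c * u)))%:E.
Proof.
move=> c0 u0; rewrite -(workload_gtE hX c0 0 u0).
have := queue_law hQ (n := 1) (t := fun=> 0) (A := fun=> [set z | (u%:E < z)%E]).
move=> /(_ _ _).
have E (U : Type) (Z : U -> \bar R) : [set w | 'I_1 -> [set z | (u%:E < z)%E] (Z w)] =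
    [set w | (u%:E < Z w)%E].
  by apply/seteqP; split => w //= /(_ ord0).
rewrite !E => <- //.
by move=> _; rewrite -[X in measurable X]setTI; apply: measurable_lte.
Qed.

End queue_transfer.

(** * Pathwise estimates off a rare fluctuation event *)

Section fluctuation.
Context (R : realType) (d : measure_display) (T : measurableType d)
  (P : probability T R) (X : R -> T -> R) (c kappa S v : R).
Hypotheses (hX : gaussian_walks P X) (c0 : 0 < c) (k0 : 0 < kappa).

(** The drift [kappa] is unrelated to [c]: over [[0, S]] it lowers the path by at most [kappa S],
    whence the level [v - kappa S]. Using [X] and [- X] controls both signs. *)
Definition large_fluctuation : set T :=
  [set w | ((v - kappa * S)%:E < workload kappa X 0 w)%E] `|`
  [set w | ((v - kappa * S)%:E < workload kappa (fun t w => (- X t w)%R) 0 w)%E].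

Lemma measurable_large_fluctuation : measurable large_fluctuation.
Proof.
apply: measurableU; first exact: measurable_workload_gt hX _ _.
exact: measurable_workload_gt (gaussian_walks_opp hX) _ _.
Qed.

Lemma large_fluctuation_le :
  (P large_fluctuation <= (2 * expR (- (2 * kappa * (v - kappa * S))))%:E)%E.
Proof.
have m1 := measurable_workload_gt kappa hX 0 (v - kappa * S).
have m2 := measurable_workload_gt kappa (gaussian_walks_opp hX) 0 (v - kappa * S).
apply: (le_trans (measureU2 P m1 m2)).
rewrite (_ : 2 * _ = expR (- (2 * kappa * (v - kappa * S))) +
  expR (- (2 * kappa * (v - kappa * S)))); last by ring.
rewrite [leRHS]EFinD; apply: leeD; first exact: workload_le.
exact: workload_le (gaussian_walks_opp hX) _ _ _.
Qed.

Lemma small_fluctuation w s : ~ large_fluctuation w -> 0 <= s <= S ->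
  `|X s w - X 0 w| <= v.
Proof.
move=> /not_orP[N1 N2] /andP[s0 sS].
have H (Y : R -> T -> R) : ~ ((v - kappa * S)%:E < workload kappa Y 0 w)%E ->
    Y s w - Y 0 w <= v.
  move=> N; rewrite leNgt; apply/negP => vY; apply: N.
  apply/workload_gtP; exists s => //; rewrite subr0.
  by have : kappa * s <= kappa * S by [rewrite ler_pM2l|]; lra.
rewrite ler_norml H// andbT.
have := H _ N2; lra.
Qed.

Context (w : T).
Hypothesis small : ~ large_fluctuation w.

Let incr s t : 0 <= s <= S -> 0 <= t <= S -> X s w - X t w <= 2 * v.
Proof.
move=> /(small_fluctuation small) + /(small_fluctuation small).
by rewrite !ler_norml; lra.
Qed.

(** A time [s] witnessing the level [u] from 0 cannot precede [t], since the path stays within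
    [v <= u] before [S]; so it also serves from [t], with a loss of at most [v]. *)
Lemma workload_persists t u y : 0 <= t <= S -> v <= u -> y <= u - v ->
  (u%:E < workload c X 0 w)%E -> (y%:E < workload c X t w)%E.
Proof.
move=> tS vu yu /workload_gtP[s s0]; rewrite subr0 => us.
have /andP[t0 _] := tS.
have := small_fluctuation small tS; rewrite ler_norml => /andP[_ Xt].
have cs : 0 <= c * s by rewrite mulr_ge0// ltW.
have ct : 0 <= c * t by rewrite mulr_ge0// ltW.
apply/workload_gtP; exists s; last by lra.
rewrite leNgt; apply/negP => st.
have /(small_fluctuation small) : 0 <= s <= S.
  by rewrite s0 (le_trans (ltW st))//; case/andP: tS.
by rewrite ler_norml => /andP[_ Xs]; lra.
Qed.

(* Off the fluctuation event, high levels are only reached through the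
   workload at the horizon [S]. *)
Lemma workload_horizon t y : 0 <= t <= S -> 2 * v <= y ->
  (y%:E < workload c X t w)%E <->
  (y%:E < workload c X S w + (X S w - X t w - c * (S - t))%:E)%E.
Proof.
move=> tS vy; have /andP[t0 tleS] := tS.
have E : (y%:E < workload c X S w + (X S w - X t w - c * (S - t))%:E)%E =
    ((y - (X S w - X t w - c * (S - t)))%:E < workload c X S w)%E.
  by rewrite [(y - _)%:E]EFinB lteBlDr.
rewrite E !workload_gtP; split=> [[s ts ys]|[s Ss ys]].
  exists s; last by lra.
  rewrite leNgt; apply/negP => sS.
  have s0S : 0 <= s <= S by rewrite (le_trans t0 ts) ltW.
  have := incr s0S tS.
  by have : 0 <= c * (s - t) by [rewrite mulr_ge0 ?subr_ge0// ltW|]; lra.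
by exists s; [exact: le_trans Ss|lra].
Qed.

(** Going back from [t] to 0 loses at most [v] on the path and [c S] on the drift. At high levels
    the conditioning event is thus automatic. *)
Lemma workload_at_origin t u y : 0 <= t <= S -> u + v + c * S <= y ->
  (y%:E < workload c X t w)%E -> (u%:E < workload c X 0 w)%E.
Proof.
move=> tS uy /workload_gtP[s ts ys]; have /andP[t0 tleS] := tS.
have := small_fluctuation small tS; rewrite ler_norml => /andP[Xt _].
apply/workload_gtP; exists s; first exact: le_trans ts.
rewrite subr0.
by have : c * t <= c * S by [rewrite ler_pM2l|]; lra.
Qed.

End fluctuation.

(** * Time reversal at the horizon *)

Section horizon.
Context (R : realType) (d : measure_display) (T : measurableType d)
  (P : probability T R) (X : R -> T -> R) (c S T1 T2 : R).
Hypotheses (hX : gaussian_walks P X) (S0 : 0 < S)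
  (T10 : 0 <= T1) (T12 : T1 <= T2) (ST : S = T1 + T2).

(* The workload at time [S] in terms of the dyadic increments from [0]. *)
Definition future (f : nat * nat -> R) : \bar R :=
  ereal_sup [set (f i - f (0%N, 1%N) - c * (dyadic S i.1 i.2 - S))%:E
            | i in [set i | (2 ^ i.1 <= i.2)%N]].

(** The coordinate [(0, 1)] is time [S], so this is the part of the workload that passes through the
    horizon. *)
Definition via_horizon (f : nat * nat -> R) (i : nat * nat) : \bar R :=
  (future f + (f (0%N, 1%N) - f i - c * (S - dyadic S i.1 i.2))%:E)%E.

Let dyadicD m k : dyadic S m (2 ^ m + k) = S + dyadic S m k.
Proof.
rewrite /dyadic natrD mulrDl natrX; congr (_ + _).
by rewrite mulrC divfK// expf_neq0// pnatr_eq0.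
Qed.

Let dyadic01 : dyadic S 0 1 = S.
Proof. by rewrite -[1%N]/(2 ^ 0 + 0)%N dyadicD /dyadic mul0r addr0. Qed.

Let future_gtP f y : (y%:E < future f)%E <->
  exists m k, y < f (m, (2 ^ m + k)%N) - f (0%N, 1%N) - c * dyadic S m k.
Proof.
split=> [/ereal_sup_gt[_ [[m k] /= mk <-]]|[m [k ymk]]].
  rewrite lte_fin => H; exists m, (k - 2 ^ m)%N; rewrite subnKC//.
  by rewrite -(subnKC mk) dyadicD [S + _ - S]addrAC subrr add0r subnKC in H.
apply: (@lt_le_trans _ _
  (f (m, (2 ^ m + k)%N) - f (0%N, 1%N) - c * dyadic S m k)%:E).
  by rewrite lte_fin.
apply: ereal_sup_ubound; exists (m, (2 ^ m + k)%N); first exact: leq_addr.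
by rewrite /= dyadicD [S + _ - S]addrAC subrr add0r.
Qed.

Lemma future_forward w : future (fun i => forward X S i w) = workload c X S w.
Proof.
apply: eq_ereal_gtP => y; rewrite future_gtP (workload_gt_dyadic c hX S w y S0).
split=> -[m [k]] H; exists m, k; move: H;
  by rewrite /forward /= dyadicD dyadic01 => H; lra.
Qed.

Lemma future_reversed w : future (fun i => reversed X S i w) = workload c X 0 w.2.
Proof.
apply: eq_ereal_gtP => y; rewrite future_gtP (workload_gt_dyadic c hX 0 w.2 y S0).
have E m k : reversed X S (m, (2 ^ m + k)%N) w - reversed X S (0%N, 1%N) w =
    X (dyadic S m k) w.2 - X 0 w.2.
  rewrite /reversed /= dyadic01 subrr.
  (* [k = 0] is the junction time [S], still in the first branch of [reversed]; both sides vanish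
     there. *)
  case: k => [|k]; last first.
    rewrite ifF; last by lia.
    by rewrite dyadicD [S + _ - S]addrAC subrr add0r; ring.
  by rewrite addn0 leqnn -[(2 ^ m)%N]addn0 dyadicD /dyadic mul0r addr0 !subrr.
by split=> -[m [k]] H; exists m, k; move: H; rewrite E add0r.
Qed.

Lemma via_horizon_forward w i : via_horizon (fun i => forward X S i w) i =
  (workload c X S w +
   (X S w - X (dyadic S i.1 i.2) w - c * (S - dyadic S i.1 i.2))%:E)%E.
Proof.
rewrite /via_horizon future_forward /forward /= dyadic01; congr (_ + _%:E)%E.
by ring.
Qed.

(** Centred at [X 0 w] because [B] vanishes at 0 only almost surely. *)
Definition drifted (s : R) (w : T) : R := X s w - X 0 w - c * s.

Lemma via_horizon_reversed w i : (i.2 <= 2 ^ i.1)%N ->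
  via_horizon (fun i => reversed X S i w) i =
  (workload c X 0 w.2 + (drifted (S - dyadic S i.1 i.2) w.1)%:E)%E.
Proof.
move=> i1; rewrite /via_horizon future_reversed /reversed /= i1.
by rewrite dyadic01 subrr /drifted; congr (_ + _%:E)%E; ring.
Qed.

Lemma measurable_future (d' : measure_display) (U : measurableType d')
    (F : nat * nat -> U -> R) : (forall i, measurable_fun setT (F i)) ->
  measurable_fun setT (fun w => future (fun i => F i w)).
Proof.
move=> mF; apply: (measurability _ (ErealGenOInfty.measurableE R)) => _ [_ [y ->] <-].
rewrite setTI; have -> : (fun w => future (fun i => F i w)) @^-1` `]y%:E, +oo[ =
   \bigcup_m \bigcup_k [set w | y <
     F (m, (2 ^ m + k)%N) w - F (0%N, 1%N) w - c * dyadic S m k].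
  apply/seteqP; split => w /=; rewrite in_itv/= andbT future_gtP.
    by move=> [m [k H]]; exists m => //; exists k.
  by move=> [m _ [k _ H]]; exists m, k.
apply: bigcupT_measurable => m; apply: bigcupT_measurable => k.
apply: measurable_lt_set => //; apply: measurable_funB => //.
exact: measurable_funB.
Qed.

Lemma measurable_via_horizon (d' : measure_display) (U : measurableType d')
    (F : nat * nat -> U -> R) i : (forall i, measurable_fun setT (F i)) ->
  measurable_fun setT (fun w => via_horizon (fun i => F i w) i).
Proof.
move=> mF; apply: emeasurable_funD; first exact: measurable_future.
apply/measurable_EFinP; apply: measurable_funB => //.
exact: measurable_funB.
Qed.

Let dyadic_le m k : dyadic S m k <= T2 -> (k <= 2 ^ m)%N.
Proof.
move=> kT; rewrite leqNgt; apply/negP => mk.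
have : dyadic S m (2 ^ m + 0) < dyadic S m k.
  by rewrite addn0 /dyadic ltr_pM2r ?ltr_nat// divr_gt0// exprn_gt0.
rewrite dyadicD (_ : dyadic S m 0 = 0) ?addr0; last by rewrite /dyadic mul0r.
have T2S : T2 <= S by rewrite ST lerDr.
by rewrite ltNge (le_trans kT T2S).
Qed.

(** After reversal the workload at [S] depends on the second copy only and the path on [[0, S]] on
    the first, so the two become independent. *)
Lemma horizon_law x y :
  P [set w | (x%:E < occupation S T1 T2
    (via_horizon (fun i => forward X S i w)) y)%E] =
  (P \x P)%E [set w | (x%:E < occupation S T1 T2 (fun i =>
     workload c X 0 w.2 + (drifted (S - dyadic S i.1 i.2) w.1)%:E) y)%E].
Proof.
pose G : set (path_space (nat * nat) R) :=
  [set f | (x%:E < occupation S T1 T2 (via_horizon f) y)%E].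
have mG : measurable G.
  apply: (measurable_long_occupation T2 S0 T10 (v := fun=> y)) => //.
  by move=> i; apply: measurable_via_horizon => j; exact: measurable_coord.
have := forward_reversed_law hX S0 mG; rewrite /G /= => ->.
have E w : occupation S T1 T2 (via_horizon (fun i => reversed X S i w)) y =
    occupation S T1 T2 (fun i => workload c X 0 w.2 +
      (drifted (S - dyadic S i.1 i.2) w.1)%:E)%E y.
  apply: (eq_occupation S0 T10) => i y' /andP[_ iT] _.
  by rewrite via_horizon_reversed//; exact: dyadic_le iT.
by congr ((P \x P)%E _); apply/seteqP; split => w /=; rewrite E.
Qed.

End horizon.

(** * The exponential law, and conditioning on the workload at the horizon *)

Lemma exponential_prob_tail (R : realType) (rate y : R) : 0 < rate -> 0 <= y ->
  exponential_prob rate `]y, +oo[ = (expR (- rate * y))%:E.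
Proof.
move=> r0 y0; rewrite /exponential_prob integral_itv_obnd_cbnd; last first.
  by apply/measurable_EFinP/measurable_funTS; exact: measurable_exponential_pdf.
rewrite (@ge0_continuous_FTC2y _ _ (fun x => - expR (- rate * x)) _ 0).
- by rewrite sub0e -EFinN opprK.
- by move=> x _; apply: exponential_pdf_ge0; exact: ltW.
- apply: (@continuous_subspaceW R^o _ _ [set` `[0, +oo[%R]).
    by apply: subset_itvr; rewrite bnd_simp.
  exact: within_continuous_exponential_pdf.
- rewrite -oppr0; apply: cvgN.
  rewrite (_ : (fun x => expR (- rate * x)) =
               (fun z => expR (- z)) \o (fun z => rate * z)); last first.
    by apply: eq_fun => x; rewrite mulNr.
  apply: (@cvg_comp _ _ _ _ _ _ (pinfty_nbhs R)); last exact: cvgr_expR.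
  exact: gt0_cvgMry.
- by move=> x _; exact: ex_derive.
- apply: cvgN; apply/cvg_at_right_filter; apply: continuous_comp.
    by apply: continuousM => //; exact: cst_continuous.
  exact: continuous_expR.
- move=> z zy; apply: derive1_exponential_pdf; rewrite in_itv/= andbT.
  by move: zy; rewrite in_itv/= andbT; exact: le_lt_trans.
Qed.

Lemma exponential_prob_tail_lt0 (R : realType) (rate y : R) : 0 < rate -> y < 0 ->
  exponential_prob rate `]y, +oo[ = 1%E.
Proof.
move=> r0 y0; rewrite -(integral_exponential_pdf r0) /exponential_prob.
rewrite [LHS]integral_mkcond; apply: eq_integral => x _.
rewrite patchE; case: ifPn => // /negP xy; rewrite lt0_exponential_pdf//.
rewrite (le_lt_trans _ y0)// leNgt; apply/negP => yx; apply: xy.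
by rewrite inE/= in_itv/= yx.
Qed.

Section exponential_law.
Context (R : realType) (d : measure_display) (T : measurableType d)
  (P : probability T R) (W : T -> R) (rate : R).
Hypotheses (r0 : 0 < rate) (mW : measurable_fun setT W)
  (W0 : forall w, 0 <= W w)
  (tail : forall y, 0 <= y -> P [set w | y < W w] = (expR (- rate * y))%:E).

Let mW' : @measurable_fun _ _ T (measurableTypeR R) setT W := mW.
Let Y := @mfun_Sub _ _ T (measurableTypeR R) _ (mem_set mW').

Lemma law_exponential (A : set R) : measurable A ->
  P (W @^-1` A) = exponential_prob rate A.
Proof.
move=> mA.
apply: (@measure_unique _ _ (measurableTypeR R) (@RGenOInfty.G R)
  (fun k => `]- k%:R, +oo[%classic) (@RGenOInfty.measurableE R) _ _ _
  (@pushforward _ _ T (measurableTypeR R) R P Y)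
  (exponential_distribution_exponential_prob__canonical__measure_function_Measure r0)) => //.
- move=> _ _ [x ->] [y ->]; exists (Num.max x y); apply/seteqP.
  by split => z /=; rewrite !in_itv/= !andbT gt_max => /andP.
- by move=> k; exists (- k%:R).
- apply/seteqP; split => // x _; exists (Num.truncn `|x|).+1 => //=.
  rewrite in_itv/= andbT ltrNl (le_lt_trans (ler_norm _))// normrN.
  by have /andP[] := truncn_itv (normr_ge0 x).
- move=> _ [y ->]; transitivity (P [set w | y < W w]).
    congr (P _); apply/seteqP.
    by split => w /=; rewrite /preimage /= in_itv/= andbT.
  have [y0|y0] := leP 0 y; first exact: etrans (tail y0) (esym (exponential_prob_tail r0 y0)).
  apply: (etrans _ (esym (exponential_prob_tail_lt0 r0 y0))).
  rewrite -[RHS](probability_setT P); congr (P _).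
  by apply/seteqP; split => w //= _; exact: lt_le_trans (W0 w).
- move=> k; apply: (@le_lt_trans _ _ 1%E); last exact: ltry.
  by apply: probability_le1; rewrite -[X in measurable X]setTI; exact: mW.
Qed.

Lemma integral_exponential_law (f : R -> \bar R) :
  measurable_fun setT f -> (forall x, 0 <= f x)%E ->
  (\int[P]_w f (W w) =
   \int[lebesgue_measure]_q (f q * (exponential_pdf rate q)%:E))%E.
Proof.
move=> mf f0.
have mf' : @measurable_fun _ _ (measurableTypeR R) (\bar R) setT f := mf.
transitivity (\int[@pushforward _ _ T (measurableTypeR R) R P Y]_q f q)%E.
  by rewrite ge0_integral_pushforward.
rewrite (@ge0_integral_density _ _ (measurableTypeR R) lebesgue_measure
  (@pushforward _ _ T (measurableTypeR R) R P Y) (exponential_pdf rate)) //.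
- exact: measurable_exponential_pdf.
- by move=> x; apply: exponential_pdf_ge0; exact: ltW.
- by move=> A mA; exact: law_exponential.
Qed.

End exponential_law.

Section sojourn_probability.
Context (R : realType) (d : measure_display) (T : measurableType d)
  (P : probability T R) (X : R -> T -> R) (c S T1 T2 x : R).
Hypotheses (hX : gaussian_walks P X) (c0 : 0 < c) (S0 : 0 < S)
  (T10 : 0 <= T1) (T12 : T1 < T2) (ST : S = T1 + T2).

(** The function [psi]: almost surely [B 0 = 0], so this is the probability inside [Cconst]. *)
Definition sojourn_tail (y : R) : \bar R :=
  P [set w | x < sojourn T1 T2 y (fun t => drifted X c t w)].

Lemma continuous_drifted w : continuous (fun t => drifted X c t w).
Proof.
move=> t; rewrite /drifted; apply: cvgB; last by apply: cvgM => //; exact: cvg_cst.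
by apply: cvgB; [exact: (gw_continuous hX)|exact: cvg_cst].
Qed.

Lemma measurable_drifted t : measurable_fun setT (drifted X c t).
Proof.
apply: measurable_funB => //.
by apply: measurable_funB; exact: (gw_measurable hX).
Qed.

Let A := [set z : R * T | x < sojourn T1 T2 z.1 (fun t => drifted X c t z.2)].

Let mA : measurable A.
Proof.
apply: (measurable_sojourn_gt x (U := (R * T)%type)
  (Z := fun t z => drifted X c t z.2) (v := fst)) => //; first exact: ltW.
- by move=> t; apply: measurableT_comp => //; exact: measurable_drifted.
- by move=> z; exact: continuous_drifted.
Qed.

Lemma measurable_sojourn_tail : measurable_fun setT sojourn_tail.
Proof.
rewrite (_ : sojourn_tail = P \o xsection A).
  exact: measurable_fun_xsection.
apply/funext => y; rewrite /sojourn_tail /=; congr (P _).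
by apply/seteqP; split => w; rewrite /xsection /= inE.
Qed.

Lemma measurable_sojourn_event y :
  measurable [set w | x < sojourn T1 T2 y (fun t => drifted X c t w)].
Proof.
rewrite (_ : [set w | _] = xsection A y); first exact: measurable_xsection.
by apply/seteqP; split => w; rewrite /xsection /= inE.
Qed.

Lemma sojourn_reflect (q y : R) w :
  occupation S T1 T2 (fun i => (q + drifted X c (S - dyadic S i.1 i.2) w)%:E) y =
  (sojourn T1 T2 (y - q) (fun t => drifted X c t w))%:E.
Proof.
have cf : {within `[0, +oo[, continuous (fun t => q + drifted X c (S - t) w)}.
  apply: continuous_subspaceT => t; apply: cvgD; first exact: cvg_cst.
  apply: (@continuous_comp _ _ _ (fun t => S - t) (fun s => drifted X c s w)).
    by apply: cvgB => //; exact: cvg_cst.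
  exact: continuous_drifted.
rewrite -(sojourn_occupation S0 T10 (f := fun t => q + drifted X c (S - t) w) y (ltW T12) cf).
have cd : {within `[0, +oo[, continuous (fun t => drifted X c t w)}.
  by apply: continuous_subspaceT; exact: continuous_drifted.
rewrite (sojournE S0 T10 y (ltW T12) cf) (sojournE S0 T10 (y - q) (ltW T12) cd).
have K (t : R) : (T1 <= t <= T2 /\ y < q + drifted X c (S - t) w) <->
    (T1 <= S - t <= T2 /\ y - q < drifted X c (S - t) w).
  by rewrite ST; split=> -[/andP[t1 t2] H]; split; first (apply/andP; split); lra.
rewrite -[RHS](lebesgue_measure_reflect S).
  by congr lebesgue_measure; apply/seteqP; split => t /=; rewrite !in_itv/= => /K.
by rewrite -(superlevel_continuous _ S0 T10)//; exact: measurable_superlevel.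
Qed.

Let W := workload c X 0.

Let mW : measurable_fun setT W := measurable_workload c hX 0.

Lemma workload_ge0 t w : (0 <= workload c X t w)%E.
Proof.
apply: ereal_sup_ubound; exists t; first by rewrite /= in_itv/= lexx.
by rewrite !subrr mulr0 subr0.
Qed.

Let mI : measurable [set w | W w = +oo%E].
Proof.
by rewrite -[X in measurable X]setTI; exact: mW measurableT _ (emeasurable_set1 _).
Qed.

Lemma workload_infty : P [set w | workload c X 0 w = +oo%E] = 0.
Proof.
apply/eqP; rewrite eq_le measure_ge0 andbT.
apply/lee_addgt0Pr => e e0; rewrite add0e.
(* The bound [e^(-2 c y) <= 1 / (2 c y)] equals [e] at this level. *)
pose y := (2 * c * e)^-1.
have y0 : 0 < y by rewrite invr_gt0 !mulr_gt0.
apply: (@le_trans _ _ (P [set w | (y%:E < workload c X 0 w)%E])).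
  apply: le_measure; rewrite ?inE//; first exact: measurable_workload_gt hX _ _.
  by move=> w /= ->; exact: ltry.
apply: (le_trans (workload_le hX c0 _ _)); rewrite lee_fin.
have x0 : 0 < 2 * c * y by rewrite !mulr_gt0.
apply: (le_trans (expRN_le_exprV (ltn0Sn 0) x0)).
rewrite expr1 (_ : 1 / (2 * c * y) = e)// /y; field.
by rewrite !gt_eqF.
Qed.

Lemma horizon_probability y :
  (P \x P)%E [set w | (x%:E < occupation S T1 T2 (fun i =>
     workload c X 0 w.2 + (drifted X c (S - dyadic S i.1 i.2) w.1)%:E) y)%E] =
  (\int[lebesgue_measure]_q
     (sojourn_tail (y - q) * (exponential_pdf (2 * c) q)%:E))%E.
Proof.
pose D := [set w : T * T | (x%:E < occupation S T1 T2 (fun i =>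
     W w.2 + (drifted X c (S - dyadic S i.1 i.2) w.1)%:E) y)%E].
have mD : measurable D.
  apply: (measurable_long_occupation T2 S0 T10 (U := (T * T)%type)
    (F := fun i w => (W w.2 + (drifted X c (S - dyadic S i.1 i.2) w.1)%:E)%E)
    (v := fun=> y)) => //.
  move=> i; apply: emeasurable_funD; first exact: measurableT_comp.
  apply/measurable_EFinP; apply: measurableT_comp => //.
  exact: measurable_drifted.
rewrite -/W -/D.
(* The second copy is fixed first: its workload is then a constant [q], and [sojourn_reflect]
   identifies the inner probability. *)
apply: (etrans (product_probabilityE_r P P mD)).
have tail z : 0 <= z ->
    P [set w | z < (fine \o W) w] = (expR (- (2 * c) * z))%:E.
  move=> z0; rewrite mulNr -(workload_gtE hX c0 0 z0).
  have mz : measurable [set w | z < (fine \o W) w].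
    apply: measurable_lt_set => //; exact: measurableT_comp.
  (* [fine] sends [+oo] to 0, so the real-valued event misses exactly the null set of infinite
     workload. *)
  rewrite (_ : [set w | (z%:E < workload c X 0 w)%E] =
    [set w | z < (fine \o W) w] `|` [set w | W w = +oo%E]).
    rewrite measureU//; first by rewrite [X in (_ + X)%E]workload_infty adde0.
    by apply/seteqP; split => w //= [+ Wy]; rewrite Wy /= ltNge z0.
  apply/seteqP; split => w /=; rewrite /W; have := workload_ge0 0 w;
    case: (workload c X 0 w) => [r| |]//= _; rewrite ?lte_fin.
  - by left.
  - by right.
  - by case.
  - by move=> _; exact: ltry.
have mf : measurable_fun setT (fun q : R => sojourn_tail (y - q)).
  by apply: (measurableT_comp measurable_sojourn_tail); exact: measurable_funB.
have c20 : 0 < 2 * c by rewrite mulr_gt0.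
have mfW : measurable_fun setT (fine \o W) by exact: measurableT_comp.
have W0 w : 0 <= (fine \o W) w by rewrite /= fine_ge0// workload_ge0.
rewrite -(integral_exponential_law c20 mfW W0 tail mf); last by move=> z; exact: measure_ge0.
apply: ge0_ae_eq_integral => //.
- have := measurable_fun_ysection P mD.
  rewrite [X in measurable_fun _ X](_ : _ = fun w' => P [set w | D (w, w')])//.
  apply/funext => w' /=; congr (P _).
  by apply/seteqP; split => w; rewrite /ysection /= inE.
- exact: (measurableT_comp mf mfW).
exists [set w | W w = +oo%E]; split => //; first exact: workload_infty.
move=> w /= /not_implyP[_ H]; apply: contrapT => Wy; apply: H.
have Wfin : W w \is a fin_num.
  rewrite ge0_fin_numE ?workload_ge0// ltey; exact/eqP.
rewrite /sojourn_tail; congr (P _); apply/seteqP; split => w1; rewrite /D /=.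
  rewrite -(fineK Wfin); under eq_fun do rewrite -EFinD.
  by rewrite sojourn_reflect lte_fin.
rewrite -lte_fin -sojourn_reflect -{2}(fineK Wfin).
by under eq_fun do rewrite EFinD.
Qed.

End sojourn_probability.

(** * The limit constant *)

Lemma ge0_integral_reflect (R : realType) (a : R) (f : R -> \bar R) :
  measurable_fun setT f -> (forall t, 0 <= f t)%E ->
  (\int[lebesgue_measure]_t f t = \int[lebesgue_measure]_t f (a - t)%R)%E.
Proof.
move=> mf f0.
have mr : @measurable_fun _ _ (measurableTypeR R) (measurableTypeR R) setT
  (fun t : R => a - t) by exact: measurable_funB.
pose r := @mfun_Sub _ _ (measurableTypeR R) (measurableTypeR R) _ (mem_set mr).
have mf' : @measurable_fun _ _ (measurableTypeR R) (\bar R) setT f := mf.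
transitivity (\int[pushforward lebesgue_measure r]_t f t)%E.
  apply: eq_measure_integral => A mA _.
  exact/esym/(lebesgue_measure_reflect a mA).
by rewrite ge0_integral_pushforward.
Qed.

Section limit_constant.
Context (R : realType) (d : measure_display) (T : measurableType d)
  (P : probability T R) (X : R -> T -> R) (c S T1 T2 x : R).
Hypotheses (hX : gaussian_walks P X) (c0 : 0 < c) (S0 : 0 < S)
  (T10 : 0 <= T1) (T12 : T1 < T2) (ST : S = T1 + T2)
  (x0 : 0 <= x) (xT : x < T2 - T1).

Let psi := sojourn_tail P X c T1 T2 x.

Let mpsi : measurable_fun setT psi.
Proof. exact: measurable_sojourn_tail hX T10 T12. Qed.

Let psi0 y : (0 <= psi y)%E.
Proof. exact: measure_ge0. Qed.

Let psi1 y : (psi y <= 1)%E.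
Proof. by apply: probability_le1; exact: measurable_sojourn_event hX T10 T12 _. Qed.

Let cdrifted w : {within `[0, +oo[, continuous (fun t => drifted X c t w)}.
Proof. by apply: continuous_subspaceT; exact: continuous_drifted hX _. Qed.

(** The decay must beat the weight [e^(2 c y)]. Comparing with the workload of drift [2 c] doubles
    the rate to [4 c], at the cost of a constant because the time is bounded by [S]. *)
Lemma sojourn_tail_le y :
  (psi y <= (expR (8%:R * c ^+ 2 * S) * expR (- (4%:R * c * y)))%:E)%E.
Proof.
have k0 : 0 < 2 * c by rewrite mulr_gt0.
apply: (@le_trans _ _ (P [set w |
    ((y - 2 * c * S)%:E < workload (2 * c) X 0 w)%E])).
  apply: le_measure; rewrite ?inE.
  - exact: measurable_sojourn_event hX T10 T12 _.
  - exact: measurable_workload_gt hX _ _.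
  move=> w /=; rewrite -lte_fin (sojournE S0 T10 y (ltW T12) (@cdrifted w)) => H.
  have [t [/= tT yt]] : `[T1, T2] `&` [set t | y < drifted X c t w] !=set0.
    (* As [0 <= x], the sojourn is positive, so the level is exceeded at some time. *)
    apply/set0P/eqP => E; move: H; rewrite E measure0 lte_fin.
    by rewrite ltNge x0.
  move: tT; rewrite in_itv/= => /andP[T1t tT2]; apply/workload_gtP.
  exists t; first exact: le_trans T1t.
  have : c * t <= c * S by rewrite ler_pM2l// ST (le_trans tT2)// lerDr.
  have : 0 < c * S by rewrite mulr_gt0.
  by move: yt; rewrite /drifted subr0; lra.
apply: (le_trans (workload_le hX k0 _ _)).
rewrite lee_fin -expRD ler_expR.
by rewrite le_eqVlt; apply/orP; left; apply/eqP; ring.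
Qed.

(** Off the fluctuation event a low enough level lies below the whole path on [[T1, T2]], whose
    length exceeds [x]. This serves the positivity of the constant. *)
Lemma sojourn_tail_ge : exists y0, forall y, y <= y0 -> ((1 / 2)%:E <= psi y)%E.
Proof.
(* With [kappa = 1], the bad event has probability at most [2 e^(-4)], and [e^(-4) <= (2/4)^2]. *)
pose v := S + 2; exists (- v - c * S - 1) => y yy0.
have mD := measurable_large_fluctuation 1 S v hX.
have PD := large_fluctuation_le S v hX (ltr01 : 0 < 1 :> R).
have e4 : 2 * expR (- (2 * 1 * (v - 1 * S))) <= 1 / 2 :> R.
  have -> : - (2 * 1 * (v - 1 * S)) = - 4%:R :> R by rewrite /v; ring.
  have := @expRN_le_exprV R 2 4%:R isT (ltr0n _ 4).
  by rewrite expr2; lra.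
apply: (@le_trans _ _ (P (~` large_fluctuation X 1 S v))).
  rewrite probability_setC// leeBrDr; last by rewrite fin_num_measure.
  apply: (@le_trans _ _ ((1 / 2)%:E + (1 / 2)%:E)%E); last first.
    by rewrite -EFinD lee_fin; lra.
  by rewrite leeD2l// (le_trans PD)// lee_fin.
apply: le_measure; rewrite ?inE.
- exact: measurableC.
- exact: measurable_sojourn_event hX T10 T12 _.
move=> w small /=; rewrite -lte_fin (sojournE S0 T10 y (ltW T12) (@cdrifted w)).
rewrite (_ : _ `&` _ = `[T1, T2]%classic); last first.
  apply/seteqP; split => t; first by case.
  move=> tT; split => //; move: tT; rewrite /= in_itv/= => /andP[T1t tT2].
  have tS : t <= S by rewrite ST (le_trans tT2)// lerDr.
  have t0 : 0 <= t by exact: le_trans T1t.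
  have t0S : 0 <= t <= S by rewrite t0 tS.
  have := small_fluctuation ltr01 small t0S.
  rewrite ler_norml => /andP[Xt _].
  have : c * t <= c * S by rewrite ler_pM2l.
  by rewrite /drifted; lra.
by rewrite lebesgue_measure_itv/= lte_fin T12 -EFinD lte_fin.
Qed.

Let weight y : R := 2 * c * expR (2 * c * y).
Let f y : \bar R := (psi y * (weight y)%:E)%E.

Let weight0 y : 0 <= weight y.
Proof. by rewrite !mulr_ge0 ?expR_ge0// ltW. Qed.

Let mweight : measurable_fun setT weight.
Proof.
by apply: measurable_funM => //; apply: measurableT_comp.
Qed.

Let mf : measurable_fun setT f.
Proof. by apply: emeasurable_funM => //; exact/measurable_EFinP. Qed.

Let f0 y : (0 <= f y)%E.
Proof. by rewrite mule_ge0 ?lee_fin. Qed.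

Let c20 : 0 < 2 * c. Proof. by rewrite mulr_gt0. Qed.

Lemma exponential_pdf_weight z y : y <= z ->
  expR (2 * c * z) * exponential_pdf (2 * c) (z - y) = weight y.
Proof.
move=> yz; rewrite exponential_pdfE ?subr_ge0// /weight mulrCA -expRD.
by congr (_ * expR _); ring.
Qed.

(** Substituting [q = z - y], the density times [e^(2 c z)] no longer depends on [z], which survives
    only as the point where the density is cut off. *)
Lemma horizon_integral z :
  ((expR (2 * c * z))%:E * \int[lebesgue_measure]_q
     (psi (z - q) * (exponential_pdf (2 * c) q)%:E) =
   \int[lebesgue_measure]_(y in `]-oo, z]) f y)%E.
Proof.
have me : measurable_fun setT (fun q : R => (exponential_pdf (2 * c) q)%:E).
  by apply/measurable_EFinP; exact: measurable_exponential_pdf.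
have e0 q : (0 <= (exponential_pdf (2 * c) q)%:E)%E.
  by rewrite lee_fin exponential_pdf_ge0// ltW.
have mg : measurable_fun setT
    (fun q : R => psi (z - q) * (exponential_pdf (2 * c) q)%:E)%E.
  apply: emeasurable_funM => //; apply: (measurableT_comp mpsi).
  exact: measurable_funB.
have g0 q : (0 <= psi (z - q) * (exponential_pdf (2 * c) q)%:E)%E.
  exact: mule_ge0.
rewrite (ge0_integral_reflect z mg g0) -ge0_integralZl; last 4 first.
- exact: measurableT.
- apply: emeasurable_funM.
    apply: (measurableT_comp mpsi); apply: measurable_funB => //.
    exact: measurable_funB.
  by apply: (measurableT_comp me); exact: measurable_funB.
- by move=> t _; exact: g0.
- by rewrite lee_fin expR_ge0.
rewrite [RHS]integral_mkcond; apply: eq_integral => y _.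
rewrite subKr patchE muleCA -EFinM; case: ifPn.
  by rewrite inE/= in_itv/= => yz; rewrite exponential_pdf_weight.
move=> /negP yz; rewrite lt0_exponential_pdf ?mulr0 ?mule0//.
rewrite subr_lt0 ltNge; apply/negP => yz'; apply: yz.
by rewrite inE/= in_itv.
Qed.

Lemma integral_weight_tail z : 0 <= z ->
  (\int[lebesgue_measure]_(y in `]z, +oo[) f y <=
   (expR (8%:R * c ^+ 2 * S) * expR (- (2 * c * z)))%:E)%E.
Proof.
move=> z0; rewrite -mulNr EFinM -(exponential_prob_tail c20 z0).
rewrite /exponential_prob -ge0_integralZl; last 4 first.
- exact: measurable_itv.
- by apply/measurable_EFinP/measurable_funTS; exact: measurable_exponential_pdf.
- by move=> y _; rewrite lee_fin exponential_pdf_ge0// ltW.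
- by rewrite lee_fin expR_ge0.
apply: ge0_le_integral => //.
- exact: measurable_funTS.
- apply: emeasurable_funM => //.
  by apply/measurable_EFinP/measurable_funTS; exact: measurable_exponential_pdf.
(* The rates [-4 c] and [2 c] add up to [-2 c], so the bound is a multiple of an exponential
   density. *)
move=> y; rewrite /= in_itv/= andbT => zy.
apply: (@le_trans _ _ ((expR (8%:R * c ^+ 2 * S) * expR (- (4%:R * c * y)))%:E *
   (weight y)%:E)%E).
  by rewrite lee_wpmul2r ?lee_fin// sojourn_tail_le.
rewrite -!EFinM lee_fin -[leLHS]mulrA ler_wpM2l ?expR_ge0//.
rewrite exponential_pdfE; last by rewrite (le_trans z0)// ltW.
rewrite /weight mulrCA -expRD le_eqVlt; apply/orP; left; apply/eqP.
by congr (_ * expR _); ring.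
Qed.

Definition limit_integral : \bar R := (\int[lebesgue_measure]_y f y)%E.

Lemma limit_integral_split z : limit_integral =
  (\int[lebesgue_measure]_(y in `]-oo, z]) f y +
   \int[lebesgue_measure]_(y in `]z, +oo[) f y)%E.
Proof.
rewrite /limit_integral -ge0_integral_setU//.
- by congr (integral _ _ _); apply/seteqP; split => y //= _;
    rewrite !in_itv/= andbT; have [yz|yz] := leP y z; [left|right].
- exact: measurable_funTS.
- apply/disj_setPS => y [] /=; rewrite !in_itv/= andbT => yz zy.
  by move: (lt_le_trans zy yz); rewrite ltxx.
Qed.

Lemma limit_integral_fin : limit_integral \is a fin_num.
Proof.
rewrite ge0_fin_numE; last exact: integral_ge0.
rewrite (limit_integral_split 0) lte_add_pinfty//; last first.
  exact: le_lt_trans (integral_weight_tail (lexx 0)) (ltry _).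
(* The part below 0 is a horizon probability, hence at most the mass of the exponential density. *)
rewrite -horizon_integral mulr0 expR0 mul1e.
apply: (@le_lt_trans _ _ 1%E); last exact: ltry.
rewrite -(integral_exponential_pdf c20); apply: ge0_le_integral => //.
- move=> q _; rewrite mule_ge0// lee_fin exponential_pdf_ge0//; exact: ltW.
- apply: emeasurable_funM; last first.
    by apply/measurable_EFinP; exact: measurable_exponential_pdf.
  by apply: (measurableT_comp mpsi); exact: measurable_funB.
- by apply/measurable_EFinP; exact: measurable_exponential_pdf.
- move=> q _; rewrite -[leRHS]mul1e lee_wpmul2r//.
  by rewrite lee_fin exponential_pdf_ge0// ltW.
Qed.

Lemma limit_integral_gt0 : (0 < limit_integral)%E.
Proof.
have [y0 Hy0] := sojourn_tail_ge.
pose y1 := y0 - 1; have y1y0 : y1 < y0 by rewrite ltrBlDr ltrDl.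
pose k := 1 / 2 * weight y1.
have k0 : 0 < k by rewrite mulr_gt0// mulr_gt0// expR_gt0.
apply: (@lt_le_trans _ _ (\int[lebesgue_measure]_(y in `[y1, y0]) k%:E)%E).
  rewrite integral_cst// [X in (_ * X)%E]lebesgue_measure_itv/= lte_fin y1y0.
  by rewrite -EFinD -EFinM lte_fin mulr_gt0// subr_gt0.
apply: (@le_trans _ _ (\int[lebesgue_measure]_(y in `[y1, y0]) f y)%E).
  apply: ge0_le_integral => //.
  - by move=> y _; rewrite lee_fin ltW.
  - exact: measurable_funTS.
  move=> y; rewrite /= in_itv/= => /andP[yy1 yy0].
  rewrite /k EFinM; apply: lee_pmul => //; rewrite ?lee_fin//; first exact: Hy0.
  by rewrite ler_pM2l// ler_expR ler_pM2l.
by apply: ge0_subset_integral.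
Qed.

End limit_constant.

Lemma littleo_linear (R : realType) (b : R) (omega : R -> R) :
  (forall u : R, omega u = b * u +o_(u \near pinfty_nbhs R) u) ->
  forall e, 0 < e -> \forall u \near +oo, `|omega u - b * u| <= e * `|u|.
Proof.
move=> homega e e0; have /eqaddoP : omega = (fun u => b * u) +o_ (pinfty_nbhs R) id.
  by apply/funext.
by move=> /(_ e e0).
Qed.

Section constant.
Context (R : realType) (d : measure_display) (T : measurableType d)
  (P : probability T R) (B : R -> {RV P >-> R}) (c T1 T2 x : R).
Hypotheses (hB : two_sided_BM B) (c0 : 0 < c)
  (T10 : 0 <= T1) (T12 : T1 < T2)
  (x0 : 0 <= x) (xT : x < T2 - T1).

Let X t w := B t w.
Let hX : gaussian_walks P X := BM_gaussian_walks hB.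

Lemma ae_eq_probability (E1 E2 N : set T) :
  measurable E1 -> measurable E2 -> measurable N -> P N = 0%E ->
  (forall w, ~ N w -> E1 w <-> E2 w) -> P E1 = P E2.
Proof.
move=> m1 m2 mN N0 E12.
have le E F : measurable E -> measurable F ->
    (forall w, ~ N w -> E w -> F w) -> (P E <= P F)%E.
  move=> mE mF EF; apply: (@le_trans _ _ (P (F `|` N))).
    apply: le_measure; rewrite ?inE//; first exact: measurableU.
    move=> w Ew; have [Nw|Nw] := pselect (N w); [by right|left; exact: EF Ew].
  apply: (le_trans (measureU2 P mF mN)); rewrite [X in (_ + X)%E]N0 adde0//.
by apply/eqP; rewrite eq_le !le// => w Nw; have := E12 w Nw; case.
Qed.

Lemma sojourn_tailE y :
  P [set w | x < sojourn T1 T2 y (fun t => B t w - c * t)] =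
  sojourn_tail P X c T1 T2 x y.
Proof.
have [N [mN N0 subN]] := BM_start hB.
apply: (ae_eq_probability _ _ mN N0).
- apply: (measurable_sojourn_gt x (Z := fun t w => B t w - c * t) (v := fun=> y)) => //.
  + exact: ltW.
  + by move=> t; exact: measurable_funB.
  + move=> w t; apply: cvgB; first exact: (gw_continuous hX).
    by apply: cvgM => //; exact: cvg_cst.
- exact: measurable_sojourn_event hX T10 T12 _.
move=> w Nw; have Bw : B 0 w = 0 by apply: contrapT => H; apply: Nw; exact: subN.
rewrite /= (_ : (fun t => B t w - c * t) = (fun t => drifted X c t w))//.
by apply/funext => t; rewrite /drifted /X Bw subr0.
Qed.

(** [Cconst] is a real integral, which loses information when the extended one is infinite;
    [limit_integral_fin] excludes this. *)
Lemma CconstE :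
  (Cconst B c T1 T2 x)%:E = limit_integral P X c T1 T2 x.
Proof.
have S0 : 0 < T1 + T2 by rewrite ltr_wpDl// (le_lt_trans T10).
have I_fin := limit_integral_fin hX c0 S0 T10 T12 erefl x0.
have fE : limit_integral P X c T1 T2 x = ((2 * c)%:E *
    \int[lebesgue_measure]_(y in [set: R]) (expR (2 * c * y) *
     fine (P [set w | (x < sojourn T1 T2 y (fun t => B t w - c * t))%R]))%:E)%E.
  rewrite -ge0_integralZl//.
  - apply: eq_integral => y _; rewrite sojourn_tailE.
    have hfin : sojourn_tail P X c T1 T2 x y \is a fin_num.
      by rewrite fin_num_measure//; exact: measurable_sojourn_event hX T10 T12 _.
    by rewrite -{1}(fineK hfin) -!EFinM; congr EFin; ring.
  - apply/measurable_EFinP; apply: measurable_funM.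
      by apply: measurableT_comp => //; exact: measurable_funM.
    apply: measurableT_comp => //.
    under eq_fun do rewrite sojourn_tailE.
    exact: measurable_sojourn_tail hX T10 T12.
  - by move=> y _; rewrite lee_fin mulr_ge0 ?expR_ge0// fine_ge0.
  - by rewrite lee_fin mulr_ge0// ltW.
rewrite /Cconst /Rintegral fE.
set J := (\int[_]_(y in _) _)%E in fE *.
have Jfin : J \is a fin_num.
  rewrite -[J]mul1e -[1%E]/(1%:E) -(@mulVf _ (2 * c)) ?gt_eqF ?mulr_gt0//.
  by rewrite EFinM -muleA -fE fin_numM.
by rewrite EFinM fineK.
Qed.

End constant.

(** * Asymptotics *)

Lemma cvg_exponentially (R : realType) (h : R -> R) (M k l : R) :
  0 <= M -> 0 < k ->
  (\forall u \near +oo, `|h u - l| <= M * expR (- (k * u))) -> h @ +oo --> l.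
Proof.
move=> M0 k0 H; apply/cvgrPdist_le => e e0; near=> u.
have u0 : 0 < u by near: u; exact: nbhs_pinfty_gt.
rewrite distrC; apply: (@le_trans _ _ (M * expR (- (k * u)))); first by near: u.
have ku : 0 < k * u by rewrite mulr_gt0.
apply: (@le_trans _ _ (M * (1 / (k * u)))).
  rewrite ler_wpM2l//; apply: (le_trans (expRN_le_exprV (ltn0Sn 0) ku)).
  by rewrite expr1.
rewrite mul1r ler_pdivrMr// mulrA -ler_pdivrMl ?mulr_gt0//.
Unshelve. all: by end_near. Qed.

Section estimates.
Context (R : realType) (d d' : measure_display) (T : measurableType d)
  (P : probability T R) (T' : measurableType d') (P' : probability T' R)
  (B : R -> {RV P >-> R}) (Q : R -> {RV P' >-> R}) (c T1 T2 x : R).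
Hypotheses (hB : two_sided_BM B) (c0 : 0 < c) (hQ : stationary_queue c B Q)
  (T10 : 0 <= T1) (T12 : T1 < T2) (x0 : 0 <= x) (xT : x < T2 - T1).

Let X t w := B t w.
Let hX : gaussian_walks P X := BM_gaussian_walks hB.
Local Notation S := (T1 + T2).
Let S0 : 0 < S. Proof. by rewrite ltr_wpDl// (le_lt_trans T10). Qed.

Local Notation cp y u := (cond_prob P'
  [set w | x < sojourn T1 T2 y (fun t => Q t w)] [set w | u < Q 0 w]).

Let A y u := [set w |
    (x%:E < occupation S T1 T2 (fun i => workload c X (dyadic S i.1 i.2) w) y)%E /\
    (u%:E < workload c X 0 w)%E].

Let mA y u : measurable (A y u).
Proof.
apply: measurableI; last exact: measurable_workload_gt hX _ _.
apply: (measurable_long_occupation T2 S0 T10 (v := fun=> y)) => // i.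
exact: measurable_workload hX _.
Qed.

Let cpE y u : 0 <= u -> cp y u = fine (P (A y u)) * expR (2 * c * u).
Proof.
move=> u0; rewrite /cond_prob (queue0_law hB hQ c0 u0).
by rewrite (queue_event_law hB hQ S0 T10 (ltW T12)) /= expRN invrK.
Qed.

Let fluct kappa v : 0 < kappa ->
  fine (P (large_fluctuation X kappa S v)) <=
  2 * expR (- (2 * kappa * (v - kappa * S))).
Proof.
move=> k0; rewrite -lee_fin fineK; last first.
  by rewrite fin_num_measure//; exact: measurable_large_fluctuation hX.
exact: large_fluctuation_le.
Qed.

Let fine_sub (E F D : set T) : measurable E -> measurable F -> measurable D ->
  E `<=` F `|` D -> fine (P E) <= fine (P F) + fine (P D).
Proof.
move=> mE mF mD EFD; rewrite -lee_fin EFinD !fineK ?fin_num_measure//.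
apply: le_trans (measureU2 P mF mD).
by apply: le_measure; rewrite ?inE//; exact: measurableU.
Qed.

Let grid0S i : 0 <= dyadic S i.1 i.2 <= T2 -> 0 <= dyadic S i.1 i.2 <= S.
Proof. by move=> /andP[-> /le_trans] /=; apply; rewrite lerDr. Qed.

(** Off the fluctuation event, [Q 0 > u] keeps the workload above [y] on all of [[T1, T2]]. The
    factor [e^(2 c u)] comes from conditioning. *)
Lemma low_level_estimate kappa v y u : 0 < kappa -> 0 <= u -> v <= u ->
  y + 1 <= u - v ->
  `|cp y u - 1| <= expR (2 * c * u) * (2 * expR (- (2 * kappa * (v - kappa * S)))).
Proof.
move=> k0 u0 vu yu; rewrite cpE//.
pose F := [set w | (u%:E < workload c X 0 w)%E].
have mF : measurable F by exact: measurable_workload_gt hX _ _.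
have mD := measurable_large_fluctuation kappa S v hX.
have pF : fine (P F) = expR (- (2 * c * u)) by rewrite /F (workload_gtE hX c0).
have AF : fine (P (A y u)) <= fine (P F).
  rewrite fine_le ?fin_num_measure// le_measure ?inE//.
  by move=> w [].
have FA : fine (P F) <= fine (P (A y u)) + fine (P (large_fluctuation X kappa S v)).
  apply: fine_sub => // w Fw.
  have [Dw|Dw] := pselect (large_fluctuation X kappa S v w); [by right|left].
  split => //; rewrite /occupation.
  rewrite (_ : _ `&` _ = `[T1, T2]%classic).
    by rewrite lebesgue_measure_itv/= lte_fin T12 -EFinD lte_fin.
  apply/seteqP; split => t; first by case.
  (* The index [j = 0] is a margin of 1, hence the hypothesis on [y + 1]. *)
  move=> tT; split => //; exists 0%N => N; exists N => //.
  move: tT; rewrite /= in_itv/= => /andP[T1t tT2].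
  apply: (workload_persists c0 k0 Dw _ vu _ Fw); last by rewrite invr1.
  apply: (grid0S (i := (N, dyadic_floor S N t))); rewrite dyadic_ge0//=.
  have /andP[H _] := dyadic_floor_itv N S0 (le_trans T10 T1t).
  exact: le_trans tT2.
have e1 : expR (- (2 * c * u)) * expR (2 * c * u) = 1.
  by rewrite expRN mulVf// gt_eqF// expR_gt0.
have := fluct v k0; have := expR_gt0 (2 * c * u).
move: pF AF FA e1; set E := expR (2 * c * u); set a := fine (P (A y u)).
move=> -> AF FA e1 E0 hfl.
have -> : a * E - 1 = (a - expR (- (2 * c * u))) * E by rewrite mulrBl e1.
rewrite ler_norml; apply/andP; split; last first.
  apply: (@le_trans _ _ 0); first by rewrite mulr_le0_ge0 ?subr_le0// ltW.
  by apply: mulr_ge0; [exact: ltW|rewrite mulr_ge0 ?expR_ge0].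
rewrite [E * _]mulrC -mulNr (ler_wpM2r (ltW E0))//; lra.
Qed.

(** The first error is the fluctuation event amplified by [e^(2 c y)]; the second is the part of the
    constant's integral beyond [y]. *)
Lemma high_level_estimate kappa v y u : 0 < kappa -> 0 <= u -> 0 <= y ->
  2 * v <= y -> u + v + c * S <= y ->
  `|cp y u * expR (2 * c * (y - u)) - Cconst B c T1 T2 x| <=
    expR (2 * c * y) * (2 * expR (- (2 * kappa * (v - kappa * S)))) +
    expR (8%:R * c ^+ 2 * S) * expR (- (2 * c * y)).
Proof.
move=> k0 u0 y0 vy uy; rewrite cpE//.
pose F := [set w | (x%:E < occupation S T1 T2
    (via_horizon c S (fun i => forward X S i w)) y)%E].
have mF : measurable F.
  apply: (measurable_long_occupation T2 S0 T10 (v := fun=> y)) => // i.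
  by apply: measurable_via_horizon => // j; exact: measurable_forward hX _.
have mD := measurable_large_fluctuation kappa S v hX.
pose D := large_fluctuation X kappa S v.
have occE w : ~ D w ->
    occupation S T1 T2 (fun i => workload c X (dyadic S i.1 i.2) w) y =
    occupation S T1 T2 (via_horizon c S (fun i => forward X S i w)) y.
  move=> Dw; apply: (eq_occupation S0 T10) => i y' /grid0S iS yy'.
  rewrite (via_horizon_forward c hX S0).
  by apply: (workload_horizon c0 k0 Dw) => //; exact: le_trans (ltW yy').
have AF : fine (P (A y u)) <= fine (P F) + fine (P D).
  apply: fine_sub => // w [Aw _].
  have [Dw|Dw] := pselect (D w); [by right|left].
  by rewrite /F /= -occE.
have FA : fine (P F) <= fine (P (A y u)) + fine (P D).
  apply: fine_sub => // w Fw.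
  have [Dw|Dw] := pselect (D w); [by right|left].
  have Ow : (x%:E < occupation S T1 T2
      (fun i => workload c X (dyadic S i.1 i.2) w) y)%E by rewrite occE.
  (* The occupation is positive since [0 <= x], so some grid value exceeds [y], and this already
     forces the level [u] at time 0. *)
  split => //; have [t [tT [j]]] : `[T1, T2] `&` dyadic_superlevel S
      (fun i => workload c X (dyadic S i.1 i.2) w) y !=set0.
    apply/set0P/eqP => E; move: Ow; rewrite /occupation E measure0 lte_fin.
    by rewrite ltNge x0.
  move=> /(_ 0%N)[m _ ym].
  move: tT; rewrite /= in_itv/= => /andP[T1t tT2].
  have /andP[H _] := dyadic_floor_itv m S0 (le_trans T10 T1t).
  apply: (workload_at_origin c0 k0 Dw _ _ ym).
    apply: (grid0S (i := (m, dyadic_floor S m t))); rewrite dyadic_ge0//=.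
    exact: le_trans tT2.
  by rewrite (le_trans uy)// lerDl.
pose J := (\int[lebesgue_measure]_(z in `]-oo, y])
  (sojourn_tail P X c T1 T2 x z * (2 * c * expR (2 * c * z))%:E))%E.
have PF : ((expR (2 * c * y))%:E * P F)%E = J.
  rewrite (horizon_law c hX S0 T10 (ltW T12) erefl x y).
  rewrite (horizon_probability x hX c0 S0 T10 T12 erefl y).
  exact: horizon_integral.
pose t := (\int[lebesgue_measure]_(z in `]y, +oo[)
  (sojourn_tail P X c T1 T2 x z * (2 * c * expR (2 * c * z))%:E))%E.
have t_le : (t <= (expR (8%:R * c ^+ 2 * S) * expR (- (2 * c * y)))%:E)%E.
  exact: (integral_weight_tail hX c0 S0 T10 T12 erefl x0 y0).
have t_ge0 : (0 <= t)%E.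
  apply: integral_ge0 => z _; rewrite mule_ge0 ?lee_fin ?mulr_ge0 ?expR_ge0//.
  exact: ltW.
have tfin : t \is a fin_num.
  by rewrite ge0_fin_numE// (le_lt_trans t_le)// ltry.
have PFfin : P F \is a fin_num by rewrite fin_num_measure.
have CE : Cconst B c T1 T2 x = expR (2 * c * y) * fine (P F) + fine t.
  apply: EFin_inj; rewrite (CconstE hB c0 T10 T12 x0).
  rewrite (limit_integral_split x hX c0 T10 T12 y) EFinD EFinM !fineK//.
  by rewrite PF.
rewrite CE; set E := expR (2 * c * y).
have E0 : 0 < E by exact: expR_gt0.
have -> : fine (P (A y u)) * expR (2 * c * u) * expR (2 * c * (y - u)) =
    fine (P (A y u)) * E.
  by rewrite -mulrA -expRD; congr (_ * expR _); ring.
rewrite [_ * E]mulrC opprD addrA -mulrBr.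
apply: (le_trans (ler_normB _ _)); rewrite lerD//; last first.
  by rewrite ger0_norm ?fine_ge0// -lee_fin fineK.
rewrite normrM (gtr0_norm E0) ler_pM2l//.
apply: le_trans (fluct v k0); rewrite ler_norml.
by apply/andP; split; rewrite ?lerBrDr ?lerBlDr; lra.
Qed.

End estimates.

Theorem proposition2p2 (R : realType) (d d' : measure_display)
  (T : measurableType d) (P : probability T R)
  (T' : measurableType d') (P' : probability T' R)
  (B : R -> {RV P >-> R}) (Q : R -> {RV P' >-> R})
  (c T1 T2 x a : R) (omega : R -> R)
  (hB : two_sided_BM B)
  (hc : 0 < c)
  (hQ : stationary_queue c B Q)
  (hT1 : 0 <= T1) (hT : T1 < T2) (hx : 0 <= x) (hxT : x < T2 - T1)
  (homega : forall u : R,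
     omega u = (1 + a) * u +o_(u \near pinfty_nbhs R) u) :
  (-1 < a < 0 ->
    asymp_equiv
      (fun u => cond_prob P'
         [set w | x < sojourn T1 T2 (omega u) (fun t => Q t w)]
         [set w | u < Q 0 w])
      (fun _ => 1)) /\
  (0 < a ->
    asymp_equiv
      (fun u => cond_prob P'
         [set w | x < sojourn T1 T2 (omega u) (fun t => Q t w)]
         [set w | u < Q 0 w])
      (fun u => expR (- 2 * c * (omega u - u)) * Cconst B c T1 T2 x)).
Proof.
have S0 : 0 < T1 + T2 by rewrite ltr_wpDl// (le_lt_trans hT1).
have om e := littleo_linear homega (e := e).
have big (k : R) : \forall u \near +oo, k <= u.
  by apply: nbhs_pinfty_ge; exact: num_real.
split=> [/andP[a1 a0]|a0].
  (* With [v = b u], eventually [omega u <= (1 - 3 b) u], which leaves a gap of [2 b u]. This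
     [kappa] makes the fluctuation term [e^(-4 c u)] up to a constant, against the factor
     [e^(2 c u)]. *)
  pose b := - a / 4%:R; pose kappa := 2 * c / b.
  have b0 : 0 < b by rewrite divr_gt0// oppr_gt0.
  have ab : a = - (4%:R * b) by rewrite /b; field.
  have k0 : 0 < kappa by rewrite divr_gt0// mulr_gt0.
  apply: (@cvg_exponentially _ _ (2 * expR (2 * kappa ^+ 2 * (T1 + T2))) (2 * c)).
  - by rewrite mulr_ge0 ?expR_ge0.
  - by rewrite mulr_gt0.
  near=> u.
  have u0 : 0 < u by near: u; exact: nbhs_pinfty_gt.
  have ub : 1 <= 2 * b * u.
    have : (2 * b)^-1 * 1 <= u by near: u; exact: big.
    by rewrite ler_pdivrMl// mulr_gt0.
  have : `|omega u - (1 + a) * u| <= b * `|u| by near: u; exact: om.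
  rewrite (gtr0_norm u0) ler_norml => /andP[_ omu].
  rewrite divr1.
  have vu : b * u <= u by rewrite ler_piMl// ?(ltW u0)//; lra.
  have yu : omega u + 1 <= u - b * u by move: omu; rewrite ab; lra.
  apply: (le_trans (low_level_estimate hB hc hQ hT1 hT hxT k0 (ltW u0) vu yu)).
  rewrite mulrCA -[leRHS]mulrA ler_wpM2l// -!expRD ler_expR.
  rewrite le_eqVlt; apply/orP; left; apply/eqP.
  by rewrite /kappa; field; rewrite gt_eqF.
set C := Cconst B c T1 T2 x.
(* The ratio divides by this constant. *)
have C0 : 0 < C.
  rewrite -lte_fin (CconstE hB hc hT1 hT hx).
  exact: limit_integral_gt0 (BM_gaussian_walks hB) hc S0 hT1 hT erefl hxT.
(* With [v = b u], eventually [omega u >= (1 + 3 b) u], which leaves [2 b u] to absorb [c S]. The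
   fluctuation term is of order [e^(-4 c (2 + a) u)], enough against [e^(2 c omega(u))], where
   [omega u <= (1 + a + b) u]. *)
pose b := a / 4%:R; pose kappa := 2 * c * (2 + a) / b.
have b0 : 0 < b by rewrite divr_gt0.
have ab : a = 4%:R * b by rewrite /b; field.
have k0 : 0 < kappa by rewrite divr_gt0// !mulr_gt0// addr_gt0.
pose K := expR (8%:R * c ^+ 2 * (T1 + T2)).
pose M := 2 * expR (2 * kappa ^+ 2 * (T1 + T2)) + K.
have M0 : 0 < M by rewrite addr_gt0 ?mulr_gt0 ?expR_gt0.
apply: (@cvg_exponentially _ _ (M / C) (2 * c)).
- by rewrite divr_ge0// ltW.
- by rewrite mulr_gt0.
near=> u.
have u0 : 0 < u by near: u; exact: nbhs_pinfty_gt.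
have ub : c * (T1 + T2) <= 2 * b * u.
  have : (2 * b)^-1 * (c * (T1 + T2)) <= u by near: u; exact: big.
  by rewrite ler_pdivrMl// mulr_gt0.
have : `|omega u - (1 + a) * u| <= b * `|u| by near: u; exact: om.
rewrite (gtr0_norm u0) ler_norml => /andP[om1 om2].
have bu : 0 < b * u by rewrite mulr_gt0.
have uom : u <= omega u by move: om1; rewrite ab; lra.
have vom : 2 * (b * u) <= omega u by move: om1; rewrite ab; lra.
have cuom : u + b * u + c * (T1 + T2) <= omega u by move: om1; rewrite ab; lra.
have := high_level_estimate hB hc hQ hT1 hT hx k0 (ltW u0)
  (le_trans (ltW u0) uom) vom cuom.
set p := cond_prob _ _ _ => H.
have E : p / (expR (- 2 * c * (omega u - u)) * C) - 1 =
    (p * expR (2 * c * (omega u - u)) - C) / C.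
  rewrite mulrBl divff ?gt_eqF// invfM -expRN mulrA.
  by congr (_ * expR _ / _ - _); ring.
rewrite E normrM normfV (gtr0_norm C0) [leRHS]mulrAC ler_pM2r ?invr_gt0//.
apply: (le_trans H); rewrite /M [leRHS]mulrDl lerD//; last first.
  rewrite ler_wpM2l ?expR_ge0// ler_expR lerN2 ler_wpM2l// mulr_ge0// ltW//.
rewrite [leLHS]mulrCA -[leRHS]mulrA ler_wpM2l// -!expRD ler_expR.
have -> : - (2 * kappa * (b * u - kappa * (T1 + T2))) =
    2 * kappa ^+ 2 * (T1 + T2) - 4%:R * c * (2 + a) * u.
  by rewrite /kappa; field; rewrite gt_eqF.
have : 2 * c * omega u <= 2 * c * ((1 + a + b) * u).
  by rewrite ler_wpM2l ?mulr_ge0 ?(ltW hc)//; lra.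
have : 0 <= c * (b * u) by rewrite mulr_ge0// ltW.
have : 0 <= c * u by rewrite mulr_ge0// ltW.
rewrite ab; lra.
Unshelve. all: by end_near. Qed.
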